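(* Let $\Omega_q^!$ be $\Omega_q^!(m|n)$, and let $\mathcal U$ be $\mathcal U_q(\mathfrak{gl}(m|n))$ or $\mathcal U_q(\mathfrak{sl}(m|n))$; or, when $\mathbf{char}(q)=\ell>2$, let $\Omega_q^!$ be $\Omega_q^!(m|n,\mathbf 1)$ and let $\mathcal U$ be the restricted object $u_q(\mathfrak{gl}(m|n))$ or $u_q(\mathfrak{sl}(m|n))$. For every basis element $x^\mu\otimes x^{(\alpha)}\in\Omega_q^!$ set $$E_j.(x^\mu\otimes x^{(\alpha)})=(x_j\partial_{j+1}\sigma_j)(x^\mu\otimes x^{(\alpha)}),\qquad F_j.(x^\mu\otimes x^{(\alpha)})=(\sigma_j^{-1}x_{j+1}\partial_j)(x^\mu\otimes x^{(\alpha)})\qquad(j\in J),$$ $$K_j.(x^\mu\otimes x^{(\alpha)})=\sigma_j(x^\mu\otimes x^{(\alpha)})\ (j\in I),\qquad \mathcal K_j.(x^\mu\otimes x^{(\alpha)})=\sigma_j\sigma_{j+1}^{-1}(x^\mu\otimes x^{(\alpha)})\ (j\in J),$$ $$\sigma.(x^\mu\otimes x^{(\alpha)})=(-1)^{|\alpha|}x^\mu\otimes x^{(\alpha)}.$$ Then these formulae define on $\Omega_q^!$ the structure of a $\mathcal U$-module algebra.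
   Context: $\Bbbk$ is an algebraically closed field of characteristic zero, $q\in\Bbbk^\times$, $q^2\ne1$; $m,n\ge 0$ are integers, $I_0=\{1,\dots,m\}$, $I_1=\{m+1,\dots,m+n\}$, $I=I_0\cup I_1$, $J=\{1,\dots,m+n-1\}$. $[s]=\frac{q^s-q^{-s}}{q-q^{-1}}$; $q$-binomials ${s\brack r}=\prod_{i=1}^r\frac{v^{s-i+1}-v^{-s+i-1}}{v^i-v^{-i}}\in\mathbb Z[v,v^{-1}]$ are evaluated at $v=q$. $\mathbf{char}(q)$ is the least positive integer $\ell$ with $[\ell]=0$, and $0$ if none exists. For $a,b\in\mathbb Z^{m+n}$ put $a*b=\sum_{i>j}a_ib_j$; $\epsilon_i$ are the standard basis vectors. In this statement $\mu=(\mu_1,\dots,\mu_m)\in\{0,1\}^m$ (identified with $\mathbb Z_2^m$) is regarded as supported on $I_0$ and $\alpha=(\alpha_{m+1},\dots,\alpha_{m+n})\in\mathbb Z^n$ as supported on $I_1$; $|\cdot|$ is the sum of the entries. Quantum dual Grassmann superalgebra. $\Omega_q^!(m|n)=\Lambda_q(m)\otimes\mathcal A_{q^{-1}}(n)$ has basis $x^\mu\otimes x^{(\alpha)}$, $\mu\in\{0,1\}^m$, $\alpha\in\mathbb Z_{\ge0}^n$, with multiplication $$(x^\mu\otimes x^{(\alpha)})(x^\nu\otimes x^{(\beta)})=(-q)^{-\alpha*\nu}\,x^\mu x^\nu\otimes x^{(\alpha)}x^{(\beta)},$$ where $x^\mu x^\nu=(-q)^{-\mu*\nu}x^{\mu+\nu}$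 (zero if $\mu+\nu\notin\{0,1\}^m$) and $x^{(\alpha)}x^{(\beta)}=q^{-\alpha*\beta}\prod_{i\in I_1}{\alpha_i+\beta_i\brack\alpha_i}\,x^{(\alpha+\beta)}$. If $\mathbf{char}(q)=\ell\ge3$, $\Omega_q^!(m|n,\mathbf 1)$ is the subalgebra spanned by those $x^\mu\otimes x^{(\alpha)}$ with all $\alpha_i\le\ell-1$. Operators on $\Omega_q^!$ (with $x^{(\beta)}=0$ if some $\beta_i<0$, and in the restricted case also if some $\beta_i\geq \ell$). For $j\in I_0$: $x_j(x^\nu\otimes x^{(\alpha)})=(-q)^{-\epsilon_j*\nu}\delta_{\nu_j,0}\,x^{\nu+\epsilon_j}\otimes x^{(\alpha)}$, $\partial_j(x^\nu\otimes x^{(\alpha)})=(-q)^{\epsilon_j*\nu}\delta_{\nu_j,1}\,x^{\nu-\epsilon_j}\otimes x^{(\alpha)}$, $\sigma_j(x^\nu\otimes x^{(\alpha)})=q^{\nu_j}x^\nu\otimes x^{(\alpha)}$. For $j\in I_1$: $x_j(x^\nu\otimes x^{(\alpha)})=(-q)^{-\epsilon_j*\nu}q^{-\epsilon_j*\alpha}[\alpha_j+1]\,x^\nu\otimes x^{(\alpha+\epsilon_j)}$, $\partial_j(x^\nu\otimes x^{(\alpha)})=(-q)^{\epsilon_j*\nu}q^{\epsilon_j*\alpha}\,x^\nu\otimes x^{(\alpha-\epsilon_j)}$, $\sigma_j(x^\nu\otimes x^{(\alpha)})=q^{-\alpha_j}x^\nu\otimes x^{(\alpha)}$. Quantum superalgebra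 and bosonization. Put $q_i=q$ for $i\in I_0$, $q_i=q^{-1}$ for $i\in I_1$, $p(i)=\delta_{im}$. $U_q(\mathfrak{gl}(m|n))$ is generated by $E_j,F_j$ $(j\in J)$, $K_i^{\pm1}$ $(i\in I)$, where $\mathcal K_i=K_iK_{i+1}^{-1}$, with relations (whenever all indices are in range): $K_iK_j=K_jK_i$, $K_iK_i^{-1}=1=K_i^{-1}K_i$; $K_iE_j=q_i^{\delta_{ij}-\delta_{i,j+1}}E_jK_i$, $K_iF_j=q_i^{-\delta_{ij}+\delta_{i,j+1}}F_jK_i$; $E_iF_j-(-1)^{p(i)p(j)}F_jE_i=\delta_{ij}\frac{\mathcal K_i-\mathcal K_i^{-1}}{q_i-q_i^{-1}}$; $E_iE_j=E_jE_i$, $F_iF_j=F_jF_i$ for $|i-j|>1$; $E_i^2E_j-(q+q^{-1})E_iE_jE_i+E_jE_i^2=0$ for $|i-j|=1$, $i\ne m$, and likewise for $F$; $E_m^2=F_m^2=0$; $E_{m-1}E_mE_{m+1}E_m+E_mE_{m-1}E_mE_{m+1}+E_{m+1}E_mE_{m-1}E_m+E_mE_{m+1}E_mE_{m-1}-(q+q^{-1})E_mE_{m-1}E_{m+1}E_m=0$, and likewise for $F$. The bosonization $\mathcal U_q(\mathfrak{gl}(m|n))$ is generated by $U_q(\mathfrak{gl}(m|n))$ and $\sigma$ with $\sigma^2=1$, $\sigma E_j\sigma=(-1)^{p(j)}E_j$, $\sigma F_j\sigma=(-1)^{p(j)}F_j$, $\sigma K_i\sigma=K_i$. It is a Hopf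 algebra with $\Delta(\sigma)=\sigma\otimes\sigma$, $\Delta(K_i)=K_i\otimes K_i$, $\Delta(E_i)=E_i\otimes\mathcal K_i+\sigma^{p(i)}\otimes E_i$, $\Delta(F_i)=F_i\otimes1+\sigma^{p(i)}\mathcal K_i^{-1}\otimes F_i$, $\epsilon(\sigma)=\epsilon(K_i)=1$, $\epsilon(E_i)=\epsilon(F_i)=0$, $S(\sigma)=\sigma$, $S(K_i)=K_i^{-1}$, $S(E_i)=-\sigma^{p(i)}E_i\mathcal K_i^{-1}$, $S(F_i)=-\sigma^{p(i)}\mathcal K_iF_i$. $\mathcal U_q(\mathfrak{sl}(m|n))$ is the analogue with $\mathcal K_j^{\pm1}$ $(j\in J)$ in place of the $K_i^{\pm1}$ (generated by $E_j,F_j,\mathcal K_j^{\pm1},\sigma$). When $\mathbf{char}(q)=\ell>2$, $u_q=\mathcal U_q/(E_i^\ell,F_i^\ell\ (m\ne i\in J),\ E_m^2,\ F_m^2,\ K_i^{2\ell}-1)$ (for $\mathfrak{sl}$, $\mathcal K_i^{2\ell}-1$). For a Hopf algebra $H$, an $H$-module algebra is an algebra $A$ that is an $H$-module with $h.(ab)=\sum(h_{(1)}.a)(h_{(2)}.b)$ and $h.1=\epsilon(h)1$. *)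

(* Defs.v *)
From HB Require Import structures.
From mathcomp Require Import all_boot all_order all_algebra.
From mathcomp Require Import finmap generic_quotient ring.
From mathcomp.classical Require Import boolp.
From mathcomp.multinomials Require Import monalg.

Set Implicit Arguments.
Unset Strict Implicit.
Unset Printing Implicit Defensive.

Import GRing.Theory.
Local Open Scope ring_scope.
Local Open Scope quotient_scope.

(* Noncommutative polynomial expressions; [Cst c] stands for the scalar c
   times the unit. *)
Inductive term (k G : Type) : Type :=
| Gen of G
| Cst of k
| Add of term k G & term k G
| Mul of term k G & term k G.
Arguments Gen {k G}. Arguments Cst {k G}.

HB.instance Definition _ (k G : Type) := gen_eqMixin (term k G).
HB.instance Definition _ (k G : Type) := gen_choiceMixin (term k G).

Declare Scope term_scope.
Delimit Scope term_scope with term.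
Bind Scope term_scope with term.
Notation "0" := (Cst 0) : term_scope.
Notation "1" := (Cst 1) : term_scope.
Notation "x + y" := (Add x y) : term_scope.
Notation "x * y" := (Mul x y) : term_scope.
Notation "c *: x" := (Mul (Cst c%R) x) : term_scope.
Notation "- x" := (Mul (Cst (-1)%R) x) : term_scope.
Notation "x - y" := (Add x (Mul (Cst (-1)%R) y)) : term_scope.
Notation "x ^+ n" := (iter n (Mul x) (Cst 1%R)) : term_scope.

Fixpoint teval (k : pzRingType) (G : Type) (v : G -> k) (t : term k G) : k :=
  match t with
  | Gen x => v x
  | Cst c => c
  | Add s t => teval v s + teval v t
  | Mul s t => teval v s * teval v t
  end.

(* The congruence on expressions generated by the axioms of unital associative
   k-algebras and the relations [R]. *)
Inductive pres_eq (k : fieldType) (G : Type) (R : term k G -> term k G -> Prop) :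
  term k G -> term k G -> Prop :=
| pe_rel s t : R s t -> pres_eq R s t
| pe_refl s : pres_eq R s s
| pe_sym s t : pres_eq R s t -> pres_eq R t s
| pe_trans s t u : pres_eq R s t -> pres_eq R t u -> pres_eq R s u
| pe_add s s' t t' :
    pres_eq R s s' -> pres_eq R t t' -> pres_eq R (s + t) (s' + t')
| pe_mul s s' t t' :
    pres_eq R s s' -> pres_eq R t t' -> pres_eq R (s * t) (s' * t')
| pe_addA s t u : pres_eq R (s + (t + u)) (s + t + u)
| pe_addC s t : pres_eq R (s + t) (t + s)
| pe_add0 s : pres_eq R (0 + s) s
| pe_addN s : pres_eq R (- s + s) 0
| pe_mulA s t u : pres_eq R (s * (t * u)) (s * t * u)
| pe_mul1 s : pres_eq R (1 * s) s
| pe_mulDl s t u : pres_eq R ((s + t) * u) (s * u + t * u)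
| pe_mulDr s t u : pres_eq R (s * (t + u)) (s * t + s * u)
| pe_central c s : pres_eq R (s * Cst c) (Cst c * s)
| pe_cstD c d : pres_eq R (Cst (c + d)%R) (Cst c + Cst d)
| pe_cstM c d : pres_eq R (Cst (c * d)%R) (Cst c * Cst d).

(* An augmentation is part of the data so that the presented algebra is nonzero,
   as [algType] requires. *)
Record augpres (k : fieldType) (G : Type) := AugPres {
  ap_rel : term k G -> term k G -> Prop;
  ap_eps : G -> k;
  ap_epsP : forall s t, ap_rel s t -> teval ap_eps s = teval ap_eps t
}.

Section PresentedAlgebra.
Variables (k : fieldType) (G : Type) (P : augpres k G).

Let peq (s t : term k G) : bool := `[< pres_eq (ap_rel P) s t >].

Lemma peq_refl : reflexive peq.
Proof. by move=> s; apply/asboolP/pe_refl. Qed.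
Lemma peq_sym : symmetric peq.
Proof.
by move=> s t; apply/idP/idP => /asboolP h; apply/asboolP/pe_sym.
Qed.
Lemma peq_trans : transitive peq.
Proof.
by move=> s t u /asboolP h1 /asboolP h2; apply/asboolP/(pe_trans h1 h2).
Qed.

Canonical peq_equiv := EquivRel peq peq_refl peq_sym peq_trans.

Definition palg := {eq_quot peq_equiv}.
HB.instance Definition _ := Choice.on palg.

Definition pcls (t : term k G) : palg := \pi_(palg) t.

Lemma pclsE s t : (pcls s = pcls t) <-> pres_eq (ap_rel P) s t.
Proof.
split; last by move=> h; apply/eqmodP/asboolP.
by move/eqmodP/asboolP.
Qed.

Lemma pcls_ind (Q : palg -> Prop) : (forall t, Q (pcls t)) -> forall u, Q u.
Proof. by move=> h u; rewrite -[u]reprK; apply: h. Qed.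

Lemma pcls_repr t : pres_eq (ap_rel P) (repr (pcls t)) t.
Proof. by apply/pclsE; rewrite /pcls reprK. Qed.

Definition padd (u v : palg) : palg := pcls (repr u + repr v)%term.
Definition pmul (u v : palg) : palg := pcls (repr u * repr v)%term.
Definition popp (u : palg) : palg := pcls (- repr u)%term.
Definition pscale (c : k) (u : palg) : palg := pcls (c *: repr u)%term.

Lemma paddE s t : padd (pcls s) (pcls t) = pcls (s + t)%term.
Proof. by apply/pclsE/pe_add; apply: pcls_repr. Qed.
Lemma pmulE s t : pmul (pcls s) (pcls t) = pcls (s * t)%term.
Proof. by apply/pclsE/pe_mul; apply: pcls_repr. Qed.
Lemma poppE s : popp (pcls s) = pcls (- s)%term.
Proof. by apply/pclsE/pe_mul; [apply: pe_refl | apply: pcls_repr]. Qed.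
Lemma pscaleE c s : pscale c (pcls s) = pcls (c *: s)%term.
Proof. by apply/pclsE/pe_mul; [apply: pe_refl | apply: pcls_repr]. Qed.

Lemma paddA : associative padd.
Proof.
elim/pcls_ind=> s; elim/pcls_ind=> t; elim/pcls_ind=> u.
by rewrite !paddE; apply/pclsE/pe_addA.
Qed.
Lemma paddC : commutative padd.
Proof.
by elim/pcls_ind=> s; elim/pcls_ind=> t; rewrite !paddE; apply/pclsE/pe_addC.
Qed.
Lemma padd0 : left_id (pcls 0%term) padd.
Proof. by elim/pcls_ind=> s; rewrite paddE; apply/pclsE/pe_add0. Qed.
Lemma paddN : left_inverse (pcls 0%term) popp padd.
Proof. by elim/pcls_ind=> s; rewrite poppE paddE; apply/pclsE/pe_addN. Qed.

HB.instance Definition _ := GRing.isZmodule.Build palg paddA paddC padd0 paddN.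

Lemma pclsD s t : pcls (s + t)%term = pcls s + pcls t.
Proof. by rewrite -paddE. Qed.

Lemma pmulA : associative pmul.
Proof.
elim/pcls_ind=> s; elim/pcls_ind=> t; elim/pcls_ind=> u.
by rewrite !pmulE; apply/pclsE/pe_mulA.
Qed.
Lemma pmul1l : left_id (pcls 1%term) pmul.
Proof. by elim/pcls_ind=> s; rewrite pmulE; apply/pclsE/pe_mul1. Qed.
Lemma pmul1r : right_id (pcls 1%term) pmul.
Proof.
elim/pcls_ind=> s; rewrite pmulE; apply/pclsE.
by apply: pe_trans (pe_mul1 _ s); apply: pe_central.
Qed.
Lemma pmulDl : left_distributive pmul +%R.
Proof.
elim/pcls_ind=> s; elim/pcls_ind=> t; elim/pcls_ind=> u.
by rewrite -pclsD !pmulE -pclsD; apply/pclsE/pe_mulDl.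
Qed.
Lemma pmulDr : right_distributive pmul +%R.
Proof.
elim/pcls_ind=> s; elim/pcls_ind=> t; elim/pcls_ind=> u.
by rewrite -pclsD !pmulE -pclsD; apply/pclsE/pe_mulDr.
Qed.

Lemma teval_pres_eq s t :
  pres_eq (ap_rel P) s t -> teval (ap_eps P) s = teval (ap_eps P) t.
Proof.
elim=> {s t} //=.
- by move=> s t /(ap_epsP (a := P)).
- by move=> s t u _ -> _ ->.
- by move=> s s' t t' _ -> _ ->.
- by move=> s s' t t' _ -> _ ->.
- by move=> *; rewrite addrA.
- by move=> *; rewrite addrC.
- by move=> *; rewrite add0r.
- by move=> *; rewrite mulN1r addNr.
- by move=> *; rewrite mulrA.
- by move=> *; rewrite mul1r.
- by move=> *; rewrite mulrDl.
- by move=> *; rewrite mulrDr.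
- by move=> *; rewrite mulrC.
Qed.

Definition paug (u : palg) : k := teval (ap_eps P) (repr u).

Lemma paugE t : paug (pcls t) = teval (ap_eps P) t.
Proof. exact/teval_pres_eq/pcls_repr. Qed.

Lemma pone_neq0 : pcls 1%term != 0.
Proof.
apply/eqP => /(congr1 paug); rewrite !paugE /= => /eqP.
by rewrite oner_eq0.
Qed.

HB.instance Definition _ := GRing.Zmodule_isNzRing.Build palg
  pmulA pmul1l pmul1r pmulDl pmulDr pone_neq0.

Lemma pscaleA c d u : pscale c (pscale d u) = pscale (c * d) u.
Proof.
elim/pcls_ind: u => s; rewrite !pscaleE; apply/pclsE.
apply: pe_trans (pe_mulA _ _ _ _) _.
by apply: pe_mul (pe_refl _ _); apply/pe_sym/pe_cstM.
Qed.
Lemma pscale1 : left_id 1 pscale.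
Proof. by elim/pcls_ind=> s; rewrite pscaleE; apply/pclsE/pe_mul1. Qed.
Lemma pscaleDr : right_distributive pscale +%R.
Proof.
move=> c; elim/pcls_ind=> s; elim/pcls_ind=> t.
by rewrite -pclsD !pscaleE -pclsD; apply/pclsE/pe_mulDr.
Qed.
Lemma pscaleDl u : {morph pscale^~ u : c d / c + d}.
Proof.
elim/pcls_ind: u => s c d; rewrite !pscaleE -pclsD; apply/pclsE.
apply: pe_trans (pe_mulDl _ (Cst c) (Cst d) s).
by apply: pe_mul (pe_refl _ _); apply: pe_cstD.
Qed.

HB.instance Definition _ := GRing.Zmodule_isLmodule.Build k palg
  pscaleA pscale1 pscaleDr pscaleDl.

Lemma pclsM s t : pcls (s * t)%term = pcls s * pcls t.
Proof. by rewrite -pmulE. Qed.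
Lemma pclsZ c s : pcls (c *: s)%term = c *: pcls s.
Proof. by rewrite -pscaleE. Qed.
Lemma pcls1 : pcls 1%term = 1.
Proof. by []. Qed.

Lemma pscaleAl (c : k) (u v : palg) : c *: (u * v) = (c *: u) * v.
Proof.
elim/pcls_ind: u => s; elim/pcls_ind: v => t.
by rewrite -pclsM -!pclsZ -pclsM; apply/pclsE/pe_mulA.
Qed.
HB.instance Definition _ := GRing.Lmodule_isLalgebra.Build k palg pscaleAl.

Lemma pscaleAr (c : k) (u v : palg) : c *: (u * v) = u * (c *: v).
Proof.
elim/pcls_ind: u => s; elim/pcls_ind: v => t.
rewrite -pclsM -!pclsZ -pclsM; apply/pclsE.
apply: pe_trans (pe_mulA _ _ _ _) _; apply: pe_sym.
apply: pe_trans (pe_mulA _ _ _ _) _.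
by apply: pe_mul (pe_refl _ _); apply: pe_central.
Qed.
HB.instance Definition _ := GRing.Lalgebra_isAlgebra.Build k palg pscaleAr.

End PresentedAlgebra.

(* A list of pairs [s] stands for the tensor \sum_(p <- s) p.1 (x) p.2; two lists
   are equal in V (x) V iff every bilinear map takes the same value on them. *)
Definition tensor_eq (k : fieldType) (V : lmodType k) (s t : seq (V * V)) : Prop :=
  forall (W : lmodType k) (B : V -> V -> W),
    (forall u, linear (B u)) -> (forall v, linear (B^~ v)) ->
  \sum_(p <- s) B p.1 p.2 = \sum_(p <- t) B p.1 p.2.

(* [cop h s] means that [s] is an expression \sum h_(1) (x) h_(2) of the coproduct
   of [h], and [eps] is the counit. *)
Definition module_algebra (k : fieldType) (H : algType k)
    (cop : H -> seq (H * H) -> Prop) (eps : H -> k)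
    (A : algType k) (act : H -> A -> A) : Prop :=
  [/\ (forall h, linear (act h)) /\ (forall a, linear (act^~ a)),
      (forall a, act 1 a = a) /\
        (forall h h' a, act (h * h') a = act h (act h' a)),
      forall h s a b, cop h s ->
        act h (a * b) = \sum_(p <- s) act p.1 a * act p.2 b
    & forall h, act h 1 = eps h *: 1].

Section QNumbers.
Variables (k : fieldType) (q : k).

Definition qnum (s : nat) : k := (q ^+ s - q ^- s) / (q - q^-1).

(* [is_qchar l] states that char(q) = l. *)
Definition is_qchar (l : nat) : Prop :=
  if l is 0%N then forall s, (0 < s)%N -> qnum s != 0
  else qnum l = 0 /\ forall s, (0 < s < l)%N -> qnum s != 0.

Definition restricted_at (l : nat) : Prop := is_qchar l /\ (2 < l)%N.

(* With X = v^2 one has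
     (v^(s-i+1) - v^(-s+i-1)) / (v^i - v^(-i))
       = v^(2i-s-1) (X^(s-i+1) - 1) / (X^i - 1),
   and the powers of v multiply to v^(-r(s-r)).  The quotient of polynomials below
   is exact and has monic denominator, so it is the image in k[X] of a polynomial
   with integer coefficients; only after this division is X set to q^2, which
   makes sense also at roots of unity. *)
Definition gauss (s r : nat) : {poly k} :=
  (\prod_(i < r) ('X^(s - i) - 1)) %/ (\prod_(i < r) ('X^(i.+1) - 1)).
Definition qbin (s r : nat) : k := q ^- (r * (s - r)) * (gauss s r).[q ^+ 2].

End QNumbers.

Section QBinTheory.
Variable k : fieldType.
Local Notation "''P_' i" := ('X^i - 1 : {poly k}) (at level 0, format "''P_' i").

Let fct r : {poly k} := \prod_(i < r) 'P_(i.+1).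
Let fall s r : {poly k} := \prod_(i < r) 'P_(s - i).

Lemma fct_neq0 r : fct r != 0.
Proof.
apply/prodf_neq0 => i _; rewrite -size_poly_eq0 size_XnsubC //.
Qed.

Lemma fallSS s r : fall s.+1 r.+1 = 'P_(s.+1) * fall s r.
Proof. by rewrite /fall big_ord_recl subn0; congr (_ * _). Qed.

Lemma fallS s r : fall s r.+1 = fall s r * 'P_(s - r).
Proof. by rewrite /fall big_ord_recr. Qed.

Lemma fall_small s r : (s < r)%N -> fall s r = 0.
Proof.
by move=> h; rewrite /fall (bigD1 (Ordinal h)) //= subnn expr0 subrr mul0r.
Qed.

Lemma fall_dvd s r : exists g, fall s r = g * fct r.
Proof.
elim: s r => [|s IH] [|r].
- by exists 1; rewrite mul1r /fall /fct !big_ord0.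
- by exists 0; rewrite mul0r fall_small.
- by exists 1; rewrite mul1r /fall /fct !big_ord0.
have [g1 E1] := IH r; have [g2 E2] := IH r.+1.
exists (g1 + 'X^(r.+1) * g2).
rewrite mulrDl -mulrA -E2 fallSS fallS.
have -> : fct r.+1 = fct r * 'P_(r.+1) by rewrite /fct big_ord_recr.
rewrite mulrA -E1.
have [le_rs|lt_sr] := leqP r s; last by rewrite fall_small // !(mulr0, mul0r, addr0).
have -> : 'X^(s.+1) = 'X^(r.+1) * 'X^(s - r) :> {poly k}.
  by rewrite -exprD; congr ('X^_); rewrite addSn subnKC.
by ring.
Qed.

Lemma gauss_fct s r : gauss k s r * fct r = fall s r.
Proof.
by have [g E] := fall_dvd s r; rewrite /gauss -/(fct r) -/(fall s r) E mulpK ?fct_neq0.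
Qed.

Lemma gaussE a b : gauss k (a + b) a * fct a * fct b = fct (a + b).
Proof.
rewrite gauss_fct; elim: a => [|a IH]; first by rewrite /fall big_ord0 mul1r.
by rewrite addSn fallSS -mulrA IH /fct big_ord_recr mulrC.
Qed.

Lemma gaussA a b c :
  gauss k (a + b) a * gauss k (a + b + c) (a + b) =
  gauss k (b + c) b * gauss k (a + (b + c)) a.
Proof.
apply: (mulIf (mulf_neq0 (mulf_neq0 (fct_neq0 a) (fct_neq0 b)) (fct_neq0 c))).
transitivity (fct (a + b + c)).
  by rewrite -(gaussE (a + b)) -(gaussE a b); ring.
by rewrite -addnA -(gaussE a) -(gaussE b c); ring.
Qed.

Variable q : k.
Local Notation qbin := (qbin q).

Lemma qbinA a b c :
  qbin (a + b) a * qbin (a + b + c) (a + b) =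
  qbin (b + c) b * qbin (a + (b + c)) a.
Proof.
have E : (q ^+ (a * b) * q ^+ ((a + b) * c) = q ^+ (b * c) * q ^+ (a * (b + c)))%R.
  by rewrite -!exprD; congr (_ ^+ _); rewrite mulnDl mulnDr addnA addnC.
have G := congr1 (horner^~ (q ^+ 2)) (gaussA a b c).
rewrite /= !hornerM in G.
rewrite /qbin !addKn mulrACA G -invfM E invfM; ring.
Qed.

Lemma qbin0 s : qbin s 0 = 1.
Proof.
rewrite /qbin mul0n expr0 invr1 mul1r.
by have := gauss_fct s 0; rewrite /fct /fall !big_ord0 mulr1 => ->; rewrite hornerC.
Qed.

Lemma qbinn s : qbin s s = 1.
Proof.
rewrite /qbin subnn muln0 expr0 invr1 mul1r.
have := gaussE s 0; rewrite addn0 {2}/fct big_ord0 mulr1.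
rewrite -[RHS]mul1r => /(mulIf (fct_neq0 s)) ->.
by rewrite hornerC.
Qed.

Lemma qbin_restricted l a b : restricted_at q l ->
  (a < l)%N -> (b < l)%N -> (l <= a + b)%N -> qbin (a + b) a = 0.
Proof.
case=> + lt2l; case: l lt2l => [|l] // lt2l [ql0 qn0] lta ltb leab.
have qV0 : q - q^-1 != 0.
  have := qn0 1%N (ltnW lt2l); apply: contra_neq => E.
  by rewrite /qnum E invr0 mulr0.
have q0 : q != 0 by apply: contra_neq qV0 => ->; rewrite invr0 subr0.
have Xi i : ((q ^+ 2) ^+ i == 1) = (qnum q i == 0).
  rewrite /qnum mulf_eq0 invr_eq0 (negPf qV0) orbF -exprM mulnC exprM expr2.
  have qi0 : q ^+ i != 0 by rewrite expf_neq0.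
  rewrite subr_eq0; apply/eqP/eqP => E; last by rewrite {1}E mulVf.
  by apply: (mulIf qi0); rewrite E mulVf.
have ev r : (fct r).[q ^+ 2] = \prod_(i < r) ((q ^+ 2) ^+ i.+1 - 1).
  by rewrite /fct horner_prod; apply: eq_bigr => i _; rewrite !hornerE.
have fn0 r : (r < l.+1)%N -> (fct r).[q ^+ 2] != 0.
  move=> ltr; rewrite ev; apply/prodf_neq0 => i _.
  rewrite subr_eq0 Xi; apply: qn0 => /=.
  exact: leq_trans (ltn_ord i) ltr.
have := congr1 (horner^~ (q ^+ 2)) (gaussE a b).
rewrite /= !hornerM [RHS]ev (bigD1 (Ordinal leab)) //=.
have /eqP -> : (q ^+ 2) ^+ l.+1 == 1 by rewrite Xi ql0.
rewrite subrr mul0r => /eqP; rewrite !mulf_eq0 (negPf (fn0 _ lta)) (negPf (fn0 _ ltb)).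
by rewrite !orbF => /eqP E; rewrite /qbin E mulr0.
Qed.

End QBinTheory.

(* Indices start at 0: I is 'I_(m + n), with I_0 its first m elements, and J is
   'I_(m + n).-1.  For j : J, the indices j and j + 1 of I are [lo j] and [hi j]. *)
Section Indices.
Variables m n : nat.

Definition lo (j : 'I_(m + n).-1) : 'I_(m + n) := widen_ord (leq_pred _) j.

Lemma hi_subproof (j : 'I_(m + n).-1) : (j.+1 < m + n)%N.
Proof. by case: j => j; case: (m + n)%N => //. Qed.
Definition hi (j : 'I_(m + n).-1) : 'I_(m + n) := Ordinal (hi_subproof j).

Definition parity (j : 'I_(m + n).-1) : bool := j.+1 == m.
End Indices.

Variant gtype := GL | SL.

(* The index set of the torus generators: K_i for GL, \mathcal K_j for SL. *)
Definition torus (g : gtype) (m n : nat) : Type :=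
  match g with GL => 'I_(m + n) | SL => 'I_(m + n).-1 end.

(* \mathcal K_j in terms of the torus generators K and their inverses KV. *)
Definition cartan (g : gtype) (m n : nat) (T : Type) (mul : T -> T -> T)
    (K KV : torus g m n -> T) (j : 'I_(m + n).-1) : T :=
  match g return (torus g m n -> T) -> (torus g m n -> T) -> T with
  | GL => fun K KV => mul (K (lo j)) (KV (hi j))
  | SL => fun K _ => K j
  end K KV.

Variant gen (g : gtype) (m n : nat) : Type :=
| genE of 'I_(m + n).-1
| genF of 'I_(m + n).-1
| genK of torus g m n
| genKV of torus g m n
| genS.
Arguments genE {g m n}. Arguments genF {g m n}. Arguments genK {g m n}.
Arguments genKV {g m n}. Arguments genS {g m n}.

Section QuantumSuperalgebra.
Variables (k : fieldType) (q : k) (m n : nat) (g : gtype).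
(* [None] for the generic algebra, [Some l] for the restricted one. *)
Variable r : option nat.

Local Notation J := 'I_(m + n).-1.
Local Notation tm := (term k (gen g m n)).

Definition qq (i : 'I_(m + n)) : k := if (i < m)%N then q else q^-1.

Definition gl_weight (i : 'I_(m + n)) (j : J) : k :=
  qq i ^ ((i == lo j)%:Z - (i == hi j)%:Z).

(* The scalar chi with K_t E_j = chi E_j K_t. *)
Definition weight : torus g m n -> J -> k :=
  match g return torus g m n -> J -> k with
  | GL => gl_weight
  | SL => fun i j => gl_weight (lo i) j / gl_weight (hi i) j
  end.

Definition tE (j : J) : tm := Gen (genE j).
Definition tF (j : J) : tm := Gen (genF j).
Definition tK (t : torus g m n) : tm := Gen (genK t).
Definition tKV (t : torus g m n) : tm := Gen (genKV t).
Definition tS : tm := Gen genS.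

Definition tcK : J -> tm := cartan (@Mul k (gen g m n)) tK tKV.
Definition tcKV : J -> tm := cartan (@Mul k (gen g m n)) tKV tK.

Definition serre3 (x y : tm) : tm :=
  (x * x * y - (q + q^-1) *: (x * y * x) + y * x * x)%term.

Definition serre4 (x y z : tm) : tm :=
  (x * y * z * y + y * x * y * z + z * y * x * y + y * z * y * x
   - (q + q^-1) *: (y * x * z * y))%term.

Definition tX (b : bool) : J -> tm := if b then tE else tF.

Inductive uq_rel : tm -> tm -> Prop :=
| rel_KK s t : uq_rel (tK s * tK t) (tK t * tK s)
| rel_KKV t : uq_rel (tK t * tKV t) 1
| rel_KVK t : uq_rel (tKV t * tK t) 1
| rel_KE t j : uq_rel (tK t * tE j) (weight t j *: (tE j * tK t))
| rel_KF t j : uq_rel (tK t * tF j) ((weight t j)^-1 *: (tF j * tK t))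
| rel_EF i j :
    uq_rel (tE i * tF j - (-1) ^+ (parity i * parity j) *: (tF j * tE i))
           (((i == j)%:R / (qq (lo i) - (qq (lo i))^-1)) *: (tcK i - tcKV i))
| rel_comm b (i j : J) : (i.+1 < j)%N || (j.+1 < i)%N ->
    uq_rel (tX b i * tX b j) (tX b j * tX b i)
| rel_serre3 b (i j : J) : (i.+1 == j)%N || (j.+1 == i)%N ->
    ~~ parity i -> uq_rel (serre3 (tX b i) (tX b j)) 0
| rel_odd b i : parity i -> uq_rel (tX b i * tX b i) 0
| rel_serre4 b (i j l : J) : i.+1 = j :> nat -> j.+1 = l :> nat ->
    parity j -> uq_rel (serre4 (tX b i) (tX b j) (tX b l)) 0
| rel_SS : uq_rel (tS * tS) 1
| rel_SXS b j :
    uq_rel (tS * tX b j * tS) ((-1) ^+ parity j *: tX b j)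
| rel_SKS t : uq_rel (tS * tK t * tS) (tK t)
(* Restricted algebras have l > 2; the side condition 0 < l only keeps the
   augmentation [gen_eps] compatible with this relation for every l. *)
| rel_restr b l i : (0 < l)%N -> r = Some l -> ~~ parity i ->
    uq_rel (tX b i ^+ l) 0
| rel_restrK l t : r = Some l -> uq_rel (tK t ^+ (2 * l)) 1.

Definition gen_eps (x : gen g m n) : k :=
  match x with genE _ | genF _ => 0 | _ => 1 end.

End QuantumSuperalgebra.

Section QuantumSuperalgebraTheory.
Variables (k : fieldType) (q : k) (m n : nat) (g : gtype) (r : option nat).
Local Notation ev := (teval (@gen_eps k m n g)).

Lemma ev_tX b i : ev (tX k g b i) = 0.
Proof. by case: b. Qed.

Lemma ev_cK j : ev (tcK k g j) = 1 /\ ev (tcKV k g j) = 1.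
Proof. by case: g j => j /=; rewrite /tcK /tcKV /= ?mulr1. Qed.

Lemma ev_exp t l : ev (t ^+ l)%term = ev t ^+ l.
Proof. by elim: l => [|l IH] /=; rewrite ?expr0 // IH exprS. Qed.

Lemma uq_rel_eps s t : uq_rel q r s t -> ev s = ev t.
Proof.
case=> {s t} /=.
- by [].
- by move=> _; rewrite mulr1.
- by move=> _; rewrite mulr1.
- by move=> t j; rewrite /tE /tF /= ?(mulr0, mul0r).
- by move=> t j; rewrite /tE /tF /= ?(mulr0, mul0r).
- move=> i j; have [-> ->] := ev_cK i.
  by rewrite !mulN1r subrr !(mulr0, mul0r) subr0.
- by move=> b i j _; rewrite !ev_tX.
- by move=> b i j _ _; rewrite !ev_tX !(mulr0, addr0).
- by move=> b i _; rewrite ev_tX mul0r.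
- by move=> b i j l _ _ _; rewrite !ev_tX !(mulr0, addr0).
- by rewrite mulr1.
- by move=> b j; rewrite ev_tX !(mulr0, mul0r).
- by move=> t; rewrite !mulr1.
- by move=> b [|l] i // _ _ _; rewrite ev_exp ev_tX expr0n.
- by move=> l t rE; rewrite ev_exp expr1n.
Qed.
End QuantumSuperalgebraTheory.

(* The bosonized quantum superalgebra of gl(m|n) or sl(m|n), generic if
   [r = None] and restricted if [r = Some l]. *)
Section Uq.
Variables (k : fieldType) (q : k) (m n : nat) (g : gtype) (r : option nat).

Definition uq_pres : augpres k (gen g m n) :=
  AugPres (@uq_rel_eps k q m n g r).

Definition Uq := palg uq_pres.
HB.instance Definition _ := GRing.Algebra.on Uq.

Definition ucls (t : term k (gen g m n)) : Uq := pcls uq_pres t.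
Definition uE (j : 'I_(m + n).-1) : Uq := ucls (tE k g j).
Definition uF (j : 'I_(m + n).-1) : Uq := ucls (tF k g j).
Definition uK (t : torus g m n) : Uq := ucls (tK k t).
Definition uKV (t : torus g m n) : Uq := ucls (tKV k t).
Definition uS : Uq := ucls (tS k m n g).
Definition ucK (j : 'I_(m + n).-1) : Uq := cartan *%R uK uKV j.
Definition ucKV (j : 'I_(m + n).-1) : Uq := cartan *%R uKV uK j.

(* The graph of the coproduct: [coproduct u s] holds when [s] is an expression of
   Delta(u).  As Delta is a morphism of algebras, it is determined by its values on
   generators. *)
Inductive coproduct : Uq -> seq (Uq * Uq) -> Prop :=
| cop_S : coproduct uS [:: (uS, uS)]
| cop_K t : coproduct (uK t) [:: (uK t, uK t)]
| cop_KV t : coproduct (uKV t) [:: (uKV t, uKV t)]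
| cop_E j : coproduct (uE j) [:: (uE j, ucK j); (uS ^+ parity j, uE j)]
| cop_F j : coproduct (uF j) [:: (uF j, 1); (uS ^+ parity j * ucKV j, uF j)]
| cop_1 : coproduct 1 [:: (1, 1)]
| cop_add u v s t : coproduct u s -> coproduct v t -> coproduct (u + v) (s ++ t)
| cop_scale c u s : coproduct u s ->
    coproduct (c *: u) [seq (c *: p.1, p.2) | p <- s]
| cop_mul u v s t : coproduct u s -> coproduct v t ->
    coproduct (u * v) [seq (x.1 * y.1, x.2 * y.2) | x <- s, y <- t]
| cop_eq u s t : coproduct u s -> tensor_eq s t -> coproduct u t.

Lemma uclsC c : ucls (Cst c) = c *: 1.
Proof.
rewrite -[1]/(ucls 1%term) -pclsZ; apply/pclsE/pe_sym.
by apply: pe_trans (pe_central _ _ _) _; apply: pe_mul1.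
Qed.

Lemma coproduct_total u : exists s, coproduct u s.
Proof.
elim/pcls_ind: u; elim=> [x|c|s [s' Hs] t [t' Ht]|s [s' Hs] t [t' Ht]].
- by case: x => *; eexists;
    [apply: cop_E | apply: cop_F | apply: cop_K | apply: cop_KV | apply: cop_S].
- by eexists; rewrite -/(ucls _) uclsC; apply/cop_scale/cop_1.
- by eexists; rewrite pclsD; apply: cop_add Hs Ht.
- by eexists; rewrite pclsM; apply: cop_mul Hs Ht.
Qed.

(* Any comultiplication with the prescribed values on generators has [coproduct]
   as its graph. *)
Lemma coproductP (D : Uq -> seq (Uq * Uq)) :
  tensor_eq (D uS) [:: (uS, uS)] ->
  (forall t, tensor_eq (D (uK t)) [:: (uK t, uK t)]) ->
  (forall t, tensor_eq (D (uKV t)) [:: (uKV t, uKV t)]) ->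
  (forall j, tensor_eq (D (uE j)) [:: (uE j, ucK j); (uS ^+ parity j, uE j)]) ->
  (forall j, tensor_eq (D (uF j)) [:: (uF j, 1); (uS ^+ parity j * ucKV j, uF j)]) ->
  tensor_eq (D 1) [:: (1, 1)] ->
  (forall u v, tensor_eq (D (u + v)) (D u ++ D v)) ->
  (forall c u, tensor_eq (D (c *: u)) [seq (c *: p.1, p.2) | p <- D u]) ->
  (forall u v, tensor_eq (D (u * v))
     [seq (x.1 * y.1, x.2 * y.2) | x <- D u, y <- D v]) ->
  forall u s, coproduct u s <-> tensor_eq (D u) s.
Proof.
move=> DS DK DKV DE DF D1 Dadd Dscale Dmul.
have imp u s : coproduct u s -> tensor_eq (D u) s.
  elim=> // {u s}.
  - move=> u v s t _ IHu _ IHv W B B1 B2.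
    by rewrite (Dadd u v W B) // !big_cat /= (IHu W B) // (IHv W B).
  - move=> c u s _ IH W B B1 B2.
    rewrite (Dscale c u W B) // !big_map /=.
    by apply: (IH W (fun x y => B (c *: x) y)) => [x|y] d a b;
      rewrite ?B1 // scalerDr scalerA mulrC -scalerA; apply: B2.
  - move=> u v s t _ IHu _ IHv W B B1 B2.
    rewrite (Dmul u v W B) // !big_allpairs_dep /=.
    transitivity (\sum_(x <- D u) \sum_(y <- t) B (x.1 * y.1) (x.2 * y.2)).
      apply: eq_bigr => x _.
      apply: (IHv W (fun a b => B (x.1 * a) (x.2 * b))) => [a|a] c a1 a2.
        by rewrite mulrDr -scalerAr B1.
      by rewrite mulrDr -scalerAr; apply: B2.
    rewrite exchange_big [RHS]exchange_big; apply: eq_bigr => y _.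
    apply: (IHu W (fun a b => B (a * y.1) (b * y.2))) => [a|a] c a1 a2.
      by rewrite mulrDl -scalerAl B1.
    by rewrite mulrDl -scalerAl; apply: B2.
  - move=> u s t _ IH st W B B1 B2.
    by rewrite (IH W B) // (st W B).
move=> u s; split; first exact: imp.
have [t ct] := coproduct_total u; move=> Ds; apply: (cop_eq ct) => W B B1 B2.
by rewrite -(imp _ _ ct W B) // (Ds W B).
Qed.

Definition counit : Uq -> k := @paug _ _ uq_pres.

End Uq.

(* A pair (mu, alpha) indexes the basis element x^mu (x) x^(alpha). *)
Definition oidx (m n : nat) : Type :=
  ({ffun 'I_m -> bool} * {ffun 'I_n -> nat})%type.
HB.instance Definition _ m n := Choice.on (oidx m n).

Section Exponents.
Variables m n : nat.

(* The exponents mu and alpha as vectors supported on I_0 and on I_1. *)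
Definition vec0 (mu : {ffun 'I_m -> bool}) (i : 'I_(m + n)) : nat :=
  match split i with inl j => mu j | inr _ => 0 end.
Definition vec1 (al : {ffun 'I_n -> nat}) (i : 'I_(m + n)) : nat :=
  match split i with inl _ => 0 | inr j => al j end.

Definition star (a b : 'I_(m + n) -> nat) : nat :=
  \sum_(i < m + n) \sum_(j < m + n | (j < i)%N) a i * b j.

Definition evec (i : 'I_(m + n)) : 'I_(m + n) -> nat := fun j => (i == j).

Definition mu_add (mu nu : {ffun 'I_m -> bool}) : {ffun 'I_m -> bool} :=
  [ffun i => mu i || nu i].
Definition mu_clash (mu nu : {ffun 'I_m -> bool}) : bool :=
  [exists i, mu i && nu i].
Definition mu_set (mu : {ffun 'I_m -> bool}) (j : 'I_m) (b : bool) :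
  {ffun 'I_m -> bool} := [ffun i => if i == j then b else mu i].

Definition al_add (al be : {ffun 'I_n -> nat}) : {ffun 'I_n -> nat} :=
  [ffun i => al i + be i]%N.
Definition al_incr (al : {ffun 'I_n -> nat}) (j : 'I_n) : {ffun 'I_n -> nat} :=
  [ffun i => al i + (i == j)]%N.
Definition al_decr (al : {ffun 'I_n -> nat}) (j : 'I_n) : {ffun 'I_n -> nat} :=
  [ffun i => al i - (i == j)]%N.

Lemma starDl a a' b : star (fun i => a i + a' i)%N b = (star a b + star a' b)%N.
Proof.
rewrite /star -big_split; apply: eq_bigr => i _ /=.
by rewrite -big_split; apply: eq_bigr => j _ /=; rewrite mulnDl.
Qed.

Lemma starDr a b b' : star a (fun i => b i + b' i)%N = (star a b + star a b')%N.
Proof.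
rewrite /star -big_split; apply: eq_bigr => i _ /=.
by rewrite -big_split; apply: eq_bigr => j _ /=; rewrite mulnDr.
Qed.

Lemma eq_star a a' b b' : a =1 a' -> b =1 b' -> star a b = star a' b'.
Proof.
by move=> ea eb; apply: eq_bigr => i _; apply: eq_bigr => j _; rewrite ea eb.
Qed.

Lemma star0l b : star (fun=> 0%N) b = 0%N.
Proof. by rewrite /star big1 // => i _; rewrite big1. Qed.

Lemma star0r a : star a (fun=> 0%N) = 0%N.
Proof. by rewrite /star big1 // => i _; rewrite big1 // => j _; rewrite muln0. Qed.

Lemma vec0D mu nu : ~~ mu_clash mu nu ->
  vec0 (mu_add mu nu) =1 (fun i => vec0 mu i + vec0 nu i)%N.
Proof.
rewrite negb_exists => /forallP h i; rewrite /vec0; case: split => // j.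
by rewrite ffunE; have := h j; case: (mu j); case: (nu j).
Qed.

Lemma vec1D al be :
  vec1 (al_add al be) =1 (fun i => vec1 al i + vec1 be i)%N.
Proof. by move=> i; rewrite /vec1; case: split => // j; rewrite ffunE. Qed.

Lemma vec00 : vec0 [ffun=> false] =1 (fun=> 0%N).
Proof. by move=> i; rewrite /vec0; case: split => // j; rewrite ffunE. Qed.

Lemma vec10 : vec1 [ffun=> 0%N] =1 (fun=> 0%N).
Proof. by move=> i; rewrite /vec1; case: split => // j; rewrite ffunE. Qed.

Lemma mu_addA : associative mu_add.
Proof. by move=> a b c; apply/ffunP => i; rewrite !ffunE orbA. Qed.
Lemma al_addA : associative al_add.
Proof. by move=> a b c; apply/ffunP => i; rewrite !ffunE addnA. Qed.
Lemma mu_add0 a : mu_add [ffun=> false] a = a.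
Proof. by apply/ffunP => i; rewrite !ffunE. Qed.
Lemma mu_addr0 a : mu_add a [ffun=> false] = a.
Proof. by apply/ffunP => i; rewrite !ffunE orbF. Qed.
Lemma al_add0 a : al_add [ffun=> 0%N] a = a.
Proof. by apply/ffunP => i; rewrite !ffunE. Qed.
Lemma al_addr0 a : al_add a [ffun=> 0%N] = a.
Proof. by apply/ffunP => i; rewrite !ffunE addn0. Qed.
Lemma mu_clash0 a : mu_clash [ffun=> false] a = false.
Proof. by apply/existsP => -[i]; rewrite ffunE. Qed.
Lemma mu_clashr0 a : mu_clash a [ffun=> false] = false.
Proof. by apply/existsP => -[i]; rewrite ffunE andbF. Qed.

Lemma mu_clashA a b c :
  mu_clash a b || mu_clash (mu_add a b) c =
  mu_clash b c || mu_clash a (mu_add b c).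
Proof.
apply/orP/orP => -[] /existsP[i].
- move=> /andP[ai bi]; right; apply/existsP; exists i.
  by rewrite ffunE ai bi.
- rewrite ffunE => /andP[/orP[ai|bi] ci]; last first.
    by left; apply/existsP; exists i; rewrite bi ci.
  by right; apply/existsP; exists i; rewrite ffunE ai ci orbT.
- move=> /andP[bi ci]; right; apply/existsP; exists i.
  by rewrite ffunE bi ci orbT.
- rewrite ffunE => /andP[ai /orP[bi|ci]].
    by left; apply/existsP; exists i; rewrite ai bi.
  by right; apply/existsP; exists i; rewrite ffunE ai ci.
Qed.
End Exponents.
Arguments vec0 {m} n mu i.
Arguments vec1 m {n} al i.

Lemma malgU_scale (K : choiceType) (k : fieldType) (c : k) (x : K) :
  << c *g x >> = c *: (<< x >> : {malg k[K]}).
Proof. by apply/malgP => y; rewrite mcoeffZ !mcoeffU mulr_natr. Qed.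

(* The multiplication depends on q, whence the extra parameter. *)
Definition omega (k : fieldType) (q : k) (m n : nat) : Type := {malg k[oidx m n]}.
HB.instance Definition _ (k : fieldType) (q : k) (m n : nat) :=
  GRing.Lmodule.on (omega q m n).

(* x^mu (x) x^(alpha) *)
Definition xb (k : fieldType) (q : k) (m n : nat) (x : oidx m n) : omega q m n :=
  << x >>.

Section OmegaDef.
Variables (k : fieldType) (q : k) (m n : nat).
Local Notation idx := (oidx m n).

(* [omul_coef (mu, alpha) (nu, beta)] is the coefficient of the single basis element
   in (x^mu (x) x^(alpha)) (x^nu (x) x^(beta)). *)
Definition omul_coef (x y : idx) : k :=
  (- q) ^- star (vec1 m x.2) (vec0 n y.1) *
  ((- q) ^- star (vec0 n x.1) (vec0 n y.1) *
   (q ^- star (vec1 m x.2) (vec1 m y.2) *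
    \prod_(i < n) qbin q (x.2 i + y.2 i) (x.2 i))).
Definition omul_idx (x y : idx) : idx := (mu_add x.1 y.1, al_add x.2 y.2).
Definition omul_basis (x y : idx) : omega q m n :=
  if mu_clash x.1 y.1 then 0 else omul_coef x y *: xb q (omul_idx x y).
End OmegaDef.

(* The linear extension of [f] from the basis. *)
HB.lock Definition olift (k : fieldType) (q : k) (m n : nat) (V : lmodType k)
    (f : oidx m n -> V) (a : omega q m n) : V :=
  \sum_(x <- msupp a) a@_x *: f x.

HB.lock Definition omul (k : fieldType) (q : k) (m n : nat)
    (a b : omega q m n) : omega q m n :=
  olift (fun x => olift (omul_basis q x) b) a.

Lemma lin0 (k : fieldType) (V W : lmodType k) (f : V -> W) : linear f -> f 0 = 0.
Proof. by move/(_ (-1) 0 0); rewrite scaler0 addr0 scaleN1r addNr. Qed.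
Lemma linZ (k : fieldType) (V W : lmodType k) (f : V -> W) :
  linear f -> forall c a, f (c *: a) = c *: f a.
Proof. by move=> lf c a; have := lf c a 0; rewrite (lin0 lf) !addr0. Qed.
Lemma linD (k : fieldType) (V W : lmodType k) (f : V -> W) :
  linear f -> {morph f : a b / a + b}.
Proof. by move=> lf a b; have := lf 1 a b; rewrite !scale1r. Qed.

Section Omega.
Variables (k : fieldType) (q : k) (m n : nat).
Local Notation idx := (oidx m n).
Local Notation omega := (omega q m n).
Local Notation xb := (@xb k q m n).
Local Notation omul := (@omul k q m n).
Local Notation omul_coef := (@omul_coef k q m n).
Local Notation omul_basis := (@omul_basis k q m n).
Local Notation olift := (@olift k q m n _).

Definition oidx0 : idx := ([ffun=> false], [ffun=> 0%N]).
Definition oone : omega := xb oidx0.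

Lemma olift_sub (V : lmodType k) (f : idx -> V) (a : omega) (d : {fset idx}) :
  (msupp a `<=` d)%fset -> olift f a = \sum_(x <- d) a@_x *: f x.
Proof.
move=> sub; rewrite olift.unlock (big_fset_incl _ sub) // => x _.
by move/mcoeff_outdom => ->; rewrite scale0r.
Qed.

Lemma olift_linear (V : lmodType k) (f : idx -> V) : linear (olift f).
Proof.
move=> c a b.
pose d := (msupp (c *: a + b : {malg k[idx]}) `|` msupp a `|` msupp b)%fset.
rewrite !(olift_sub f (d := d)); last first.
- by rewrite /d -fsetUA fsubsetUl.
- by rewrite /d fsetUAC fsubsetUr.
- by rewrite /d fsubsetUr.
rewrite scaler_sumr -big_split; apply: eq_bigr => x _ /=.
by rewrite mcoeffD mcoeffZ scalerDl scalerA.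
Qed.
HB.instance Definition _ (V : lmodType k) (f : idx -> V) :=
  GRing.isLinear.Build k omega V *:%R (olift f) (olift_linear f).

Lemma olift_xb (V : lmodType k) (f : idx -> V) x : olift f (xb x) = f x.
Proof.
rewrite olift.unlock msuppU oner_eq0 big_seq_fset1.
by rewrite mcoeffUU scale1r.
Qed.

Lemma omega_eq (V : lmodType k) (f h : omega -> V) :
  linear f -> linear h -> (forall x, f (xb x) = h (xb x)) -> f =1 h.
Proof.
move=> lf lh e a.
pose F := HB.pack_for {linear omega -> V} f (GRing.isLinear.Build _ _ _ _ f lf).
pose H := HB.pack_for {linear omega -> V} h (GRing.isLinear.Build _ _ _ _ h lh).
have -> : a = \sum_(x <- msupp a) a@_x *: xb x.
  rewrite [LHS](monalgE (a : {malg k[idx]})); apply: eq_bigr => x _.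
  exact: malgU_scale.
rewrite -[f _]/(F _) -[h _]/(H _) !linear_sum; apply: eq_bigr => x _.
by rewrite !linearZ /= e.
Qed.

Lemma omul_linl b : linear (omul^~ b).
Proof. by rewrite omul.unlock; apply: olift_linear. Qed.

Lemma omul_linr a : linear (omul a).
Proof.
move=> c b b'; rewrite omul.unlock {1 3 5}olift.unlock scaler_sumr -big_split.
apply: eq_bigr => x _ /=.
by rewrite linearP scalerDr !scalerA mulrC.
Qed.

Lemma omul_xb x y : omul (xb x) (xb y) = omul_basis x y.
Proof. by rewrite omul.unlock !olift_xb. Qed.

Lemma omul0l b : omul 0 b = 0.
Proof. exact: lin0 (omul_linl b). Qed.
Lemma omul0r a : omul a 0 = 0.
Proof. exact: lin0 (omul_linr a). Qed.
Lemma omulZ_l c a b : omul (c *: a) b = c *: omul a b.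
Proof. exact: linZ (omul_linl b) c a. Qed.
Lemma omulZ_r c a b : omul a (c *: b) = c *: omul a b.
Proof. exact: linZ (omul_linr a) c b. Qed.

Lemma omul_coefA x y z : ~~ mu_clash x.1 y.1 -> ~~ mu_clash y.1 z.1 ->
  omul_coef x y * omul_coef (omul_idx x y) z =
  omul_coef y z * omul_coef x (omul_idx y z).
Proof.
move=> cxy cyz.
have E : (\prod_(i < n) qbin q (x.2 i + y.2 i) (x.2 i)) *
         (\prod_(i < n) qbin q (al_add x.2 y.2 i + z.2 i) (al_add x.2 y.2 i)) =
         (\prod_(i < n) qbin q (y.2 i + z.2 i) (y.2 i)) *
         (\prod_(i < n) qbin q (x.2 i + al_add y.2 z.2 i) (x.2 i)).
  by rewrite -!big_split; apply: eq_bigr => i _; rewrite !ffunE; apply: qbinA.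
rewrite /omul_coef; move: E.
rewrite -/(omul_idx x y).1.
move: (\prod_(i < n) qbin q (x.2 i + y.2 i) (x.2 i)) => A.
move: (\prod_(i < n) qbin q (y.2 i + z.2 i) (y.2 i)) => C.
move: (\prod_(i < n) _) (\prod_(i < n) _) => B D E.
rewrite -[(omul_idx x y).1]/(mu_add x.1 y.1) -[(omul_idx x y).2]/(al_add x.2 y.2).
rewrite -[(omul_idx y z).1]/(mu_add y.1 z.1) -[(omul_idx y z).2]/(al_add y.2 z.2).
rewrite !(eq_star (@vec1D m n x.2 y.2) (frefl _)) !(eq_star (frefl _) (@vec1D m n y.2 z.2)).
rewrite (eq_star (@vec0D m n _ _ cxy) (frefl _)) !(eq_star (frefl _) (@vec0D m n _ _ cyz)).
rewrite !starDl !starDr.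
do !move: (star _ _) => ?.
rewrite !exprD !invfM.
do !move: ((_ ^+ _)^-1) => ?.
by ring: E.
Qed.

Lemma omul_basisA x y z :
  omul (omul_basis x y) (xb z) = omul (xb x) (omul_basis y z).
Proof.
have := mu_clashA x.1 y.1 z.1; rewrite /omul_basis.
case: (boolP (mu_clash x.1 y.1)) => cxy; case: (boolP (mu_clash y.1 z.1)) => cyz.
- by rewrite omul0l omul0r.
- rewrite omul0l omulZ_r omul_xb /omul_basis orTb orFb => /esym cx.
  by rewrite cx scaler0.
- rewrite omul0r omulZ_l omul_xb /omul_basis orTb orFb => cx.
  by rewrite cx scaler0.
rewrite !orFb => cx.
rewrite omulZ_r omulZ_l !omul_xb /omul_basis.
have -> : mu_clash (omul_idx x y).1 z.1 = mu_clash x.1 (omul_idx y z).1 by [].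
case: (mu_clash x.1 (omul_idx y z).1).
  by rewrite !scaler0.
have -> : omul_idx (omul_idx x y) z = omul_idx x (omul_idx y z).
  by rewrite /omul_idx /= mu_addA al_addA.
rewrite !scalerA.
by rewrite omul_coefA.
Qed.

Lemma omulA : associative omul.
Proof.
move=> a b c; symmetry.
apply: (omega_eq (f := fun a => omul (omul a b) c) (h := fun a => omul a (omul b c))).
- by move=> d u v; rewrite !omul_linl.
- by move=> d u v; rewrite omul_linl.
move=> x.
apply: (omega_eq (f := fun b => omul (omul (xb x) b) c)
                 (h := fun b => omul (xb x) (omul b c))).
- by move=> d u v; rewrite omul_linr omul_linl.
- by move=> d u v; rewrite omul_linl omul_linr.
move=> y.
apply: (omega_eq (f := fun c => omul (omul (xb x) (xb y)) c)
                 (h := fun c => omul (xb x) (omul (xb y) c))).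
- by move=> d u v; rewrite omul_linr.
- by move=> d u v; rewrite (omul_linr (xb y)); apply: omul_linr.
by move=> z; rewrite (omul_xb x) (omul_xb y) omul_basisA.
Qed.

Lemma omul1l : left_id oone omul.
Proof.
apply: (omega_eq (f := omul oone) (h := id)) => //; first exact: omul_linr.
move=> x; rewrite omul_xb /omul_basis mu_clash0 /omul_coef /omul_idx /=.
rewrite mu_add0 al_add0 !(eq_star (@vec10 m n) (frefl _)) (eq_star (@vec00 m n) (frefl _)).
rewrite !star0l !expr0 !invr1 !mul1r big1 ?scale1r; last first.
  by move=> i _; rewrite ffunE qbin0.
by case: x.
Qed.

Lemma omul1r : right_id oone omul.
Proof.
apply: (omega_eq (f := omul^~ oone) (h := id)) => //; first exact: omul_linl.
move=> x; rewrite omul_xb /omul_basis mu_clashr0 /omul_coef /omul_idx /=.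
rewrite mu_addr0 al_addr0 !(eq_star (frefl _) (@vec00 m n)) (eq_star (frefl _) (@vec10 m n)).
rewrite !star0r !expr0 !invr1 !mul1r big1 ?scale1r; last first.
  by move=> i _; rewrite ffunE addn0 qbinn.
by case: x.
Qed.

Lemma omulDl : left_distributive omul +%R.
Proof. by move=> a b c; apply: linD (omul_linl c) a b. Qed.
Lemma omulDr : right_distributive omul +%R.
Proof. by move=> a b c; apply: linD (omul_linr a) b c. Qed.

Lemma oone_neq0 : oone != 0.
Proof. by rewrite /oone /xb monalgU_eq0 oner_eq0. Qed.

HB.instance Definition _ := GRing.Zmodule_isNzRing.Build omega
  omulA omul1l omul1r omulDl omulDr oone_neq0.

Lemma omulZl (c : k) (a b : omega) : c *: (a * b) = (c *: a) * b.
Proof. exact/esym/omulZ_l. Qed.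
HB.instance Definition _ := GRing.Lmodule_isLalgebra.Build k omega omulZl.

Lemma omulZr (c : k) (a b : omega) : c *: (a * b) = a * (c *: b).
Proof. exact/esym/omulZ_r. Qed.
HB.instance Definition _ := GRing.Lalgebra_isAlgebra.Build k omega omulZr.

Lemma xbM (x y : idx) : xb x * xb y = omul_basis x y.
Proof. exact: omul_xb. Qed.

End Omega.

Section Restricted.
Variables (k : fieldType) (q : k) (m n l : nat).

Definition al_below (al : {ffun 'I_n -> nat}) : bool := [forall i, (al i < l)%N].

(* The span of the x^mu (x) x^(alpha) with all alpha_i < l.  The argument [h] is
   not used, but closure under products depends on it. *)
Definition restr_span (h : restricted_at q l) : {pred omega q m n} :=
  fun a => all (fun x : oidx m n => al_below x.2)
               (msupp (a : {malg k[oidx m n]})).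

Variable h : restricted_at q l.

Lemma restr_spanP a :
  reflect (forall x : oidx m n, ~~ al_below x.2 ->
             (a : {malg k[oidx m n]})@_x = 0)
          (a \in restr_span h).
Proof.
apply: (iffP allP) => [H x nx|H x].
  by apply: mcoeff_outdom; apply: contra nx; apply: H.
by rewrite -mcoeff_neq0; apply: contraNT => /H ->.
Qed.

Lemma restr_submod : submod_closed (restr_span h).
Proof.
split; first by apply/restr_spanP => x _; rewrite mcoeff0.
move=> c a b /restr_spanP Ha /restr_spanP Hb; apply/restr_spanP => x nx.
by rewrite mcoeffD mcoeffZ Ha // Hb // mulr0 addr0.
Qed.

Lemma restr_xb (x : oidx m n) : al_below x.2 -> xb q x \in restr_span h.
Proof.
move=> bx; apply/restr_spanP => y ny; rewrite mcoeffU.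
by case: eqP => [E|_]; [move: ny; rewrite -E bx | rewrite mulr0n].
Qed.

Lemma omul_coef_restr (x y : oidx m n) : al_below x.2 -> al_below y.2 ->
  ~~ al_below (omul_idx x y).2 -> omul_coef q x y = 0.
Proof.
move=> /forallP bx /forallP bY; rewrite negb_forall => /existsP[i].
rewrite ffunE -leqNgt => le_l; rewrite /omul_coef (bigD1 i) //=.
by rewrite (qbin_restricted h) ?mul0r ?mulr0.
Qed.

Lemma restr_basis (x y : oidx m n) : al_below x.2 -> al_below y.2 ->
  omul_basis q x y \in restr_span h.
Proof.
move=> bx bY; have [z0 lc] := restr_submod.
rewrite /omul_basis; case: ifP => // _.
case: (boolP (al_below (omul_idx x y).2)) => [b|nb].
  by rewrite -[_ *: _]addr0 lc ?restr_xb.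
by rewrite omul_coef_restr // scale0r.
Qed.

Lemma restr_olift (f : oidx m n -> omega q m n) a : a \in restr_span h ->
  (forall x, al_below x.2 -> f x \in restr_span h) -> olift f a \in restr_span h.
Proof.
have [z0 lc] := restr_submod.
move=> /allP Sa Sf; rewrite olift.unlock big_seq.
apply: (big_ind (fun b => b \in restr_span h)) => //.
  by move=> b c Sb Sc; rewrite -[b]scale1r lc.
by move=> x /Sa bx; rewrite -[_ *: _]addr0 lc ?Sf.
Qed.

Lemma restr_subalg : subalg_closed (restr_span h).
Proof.
have [z0 lc] := restr_submod; split=> //.
  apply: restr_xb; apply/forallP => i; rewrite ffunE.
  by case: h => _; apply: leq_trans.
move=> a b Sa Sb; rewrite -[a * b]/(omul a b) omul.unlock.
by apply: restr_olift => // x bx; apply: restr_olift => // y bY; apply: restr_basis.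
Qed.

HB.instance Definition _ :=
  GRing.isSubalgClosed.Build k (omega q m n) (restr_span h) restr_subalg.

Record restr_omega : Type := RestrOmega {
  restr_val : omega q m n;
  _ : restr_val \in restr_span h
}.

HB.instance Definition _ := [isSub for restr_val].
HB.instance Definition _ := [Choice of restr_omega by <:].
HB.instance Definition _ := [SubChoice_isSubAlgebra of restr_omega by <:].
End Restricted.

Section Operators.
Variables (k : fieldType) (q : k) (m n : nat) (g : gtype).
(* [None] on the whole algebra, [Some l] on the restricted one. *)
Variable r : option nat.
Local Notation idx := (oidx m n).
Local Notation omega := (omega q m n).

(* x^nu (x) x^(beta), with the convention that x^(beta) = 0 if some beta_i >= l in
   the restricted case. *)
Definition xcap (x : idx) : omega :=
  if r is Some l then if al_below l x.2 then xb q x else 0 else xb q x.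

Definition xop (j : 'I_(m + n)) : omega -> omega := olift (fun x : idx =>
  match split j with
  | inl i => if x.1 i then 0 else
      (- q) ^- star (evec j) (vec0 n x.1) *: xcap (mu_set x.1 i true, x.2)
  | inr i =>
      ((- q) ^- star (evec j) (vec0 n x.1) * q ^- star (evec j) (vec1 m x.2)
       * qnum q (x.2 i).+1) *: xcap (x.1, al_incr x.2 i)
  end).

Definition dop (j : 'I_(m + n)) : omega -> omega := olift (fun x : idx =>
  match split j with
  | inl i => if x.1 i then
      (- q) ^+ star (evec j) (vec0 n x.1) *: xcap (mu_set x.1 i false, x.2) else 0
  | inr i => if x.2 i == 0%N then 0 else
      ((- q) ^+ star (evec j) (vec0 n x.1) * q ^+ star (evec j) (vec1 m x.2))
      *: xcap (x.1, al_decr x.2 i)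
  end).

Definition sigma_val (j : 'I_(m + n)) (x : idx) : k :=
  match split j with inl i => q ^+ x.1 i | inr i => q ^- x.2 i end.
Definition sop (j : 'I_(m + n)) : omega -> omega :=
  olift (fun x : idx => sigma_val j x *: xb q x).
Definition sopV (j : 'I_(m + n)) : omega -> omega :=
  olift (fun x : idx => (sigma_val j x)^-1 *: xb q x).

Definition torus_op : torus g m n -> omega -> omega :=
  match g return torus g m n -> omega -> omega with
  | GL => sop
  | SL => fun j => sop (lo j) \o sopV (hi j)
  end.

(* The action of the generators on the basis elements; [emb] embeds the algebra
   acted upon (the whole algebra or the restricted one) into [omega]. *)
Definition acts_by_operators (A : Type) (emb : A -> omega)
    (act : Uq q m n g r -> A -> A) : Prop :=
  forall (a : A) (x : idx), emb a = xb q x ->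
  [/\ forall j, emb (act (uE q g r j) a) =
        (xop (lo j) \o dop (hi j) \o sop (lo j)) (emb a),
      forall j, emb (act (uF q g r j) a) =
        (sopV (lo j) \o xop (hi j) \o dop (lo j)) (emb a),
      forall t, emb (act (uK q r t) a) = torus_op t (emb a),
      forall j, emb (act (ucK q g r j) a) =
        (sop (lo j) \o sopV (hi j)) (emb a)
    & emb (act (uS q m n g r) a) = (-1) ^+ (\sum_(i < n) x.2 i)%N *: emb a].
End Operators.

(* Main.v *)
Require Import Defs.
From mathcomp Require Import all_boot all_order all_algebra.
From mathcomp Require Import ring zify.
From mathcomp.multinomials Require Import monalg.

Set Implicit Arguments.
Unset Strict Implicit.
Unset Printing Implicit Defensive.

Import GRing.Theory.
Local Open Scope ring_scope.

(** The operators of the theorem are untwisted first.  For an index i let X_i raise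
    the exponent at i by one, with the q-number of the new exponent as coefficient (0
    if an exponent in I_0 would become 2), and let D_i lower it by one, with
    coefficient 1.  Up to a scalar depending only on the exponents at the indices
    below i, the operators x_i and d_i are X_i and D_i; in x_j d_{j+1} sigma_j and in
    sigma_j^-1 x_{j+1} d_j all scalars cancel, so that E_j acts as X_j D_{j+1} and
    F_j as X_{j+1} D_j ([root_op_E_twisted], [root_op_F_twisted]).

    Untwisted operators at different indices commute ([ladder_comm]).  Each relation
    of the quantum superalgebra therefore reduces to identities at a single index.
    With L, L' denoting X_i, D_i in either order, these are L L = 0 for i in I_0
    ([ladder_fermi]), the identity
    L L L' + L' L L = (q + q^-1) L L' L for i in I_1 ([ladder_bose]), which is the
    recursion [s] + [s+2] = [2][s+1], and the eigenvalues of X_i D_i and D_i X_i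
    ([ladder_number]) for the commutator of E_j and F_j.  Exchanging X and D exchanges
    E_j and F_j, so one argument, parametrized by a boolean, serves both families.
    In the restricted algebra the power l of E_j or F_j contains the power l of some
    D_i, which kills all exponents smaller than l ([root_op_nilpotent]).

    The coefficient of a product of two basis elements is a bicharacter of the
    exponents times a product over the indices of coefficients that are q-binomials
    on I_1 ([xbM_sites]).  Hence X_i (a b) is, up to scalars, both (X_i a) b and
    a (X_i b) ([raise_mull], [raise_mulr]), and the q-Pascal rule makes D_i a twisted
    derivation ([lower_mul]).  There are two q-Pascal rules: one yields the coproduct
    of E_j ([root_op_E_xbM]), the other that of F_j ([root_op_F_xbM]).  The scalars
    left over at the indices above j + 1 are trivial, except for j = m, where they
    form the sign by which sigma acts ([chi_above_lo]).  The Leibniz rule for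
    generators implies it for all elements ([uact_module_algebra]).

    All this is done in an arbitrary algebra with a basis multiplied by the above
    rule; the algebra acted upon is embedded in it, so that the whole algebra and the
    restricted one are treated together. *)

(** * Actions of presented algebras *)

Section PresentedAction.
Variables (k : fieldType) (G : Type) (A : lmodType k).
Implicit Types (s t : term k G) (a b : A).

Fixpoint tact (v : G -> A -> A) t : A -> A :=
  match t with
  | Gen x => v x
  | Cst c => fun a => c *: a
  | Add s t => fun a => tact v s a + tact v t a
  | Mul s t => fun a => tact v s (tact v t a)
  end.

Lemma tactD v s t a : tact v (Add s t) a = tact v s a + tact v t a.
Proof. by []. Qed.
Lemma tactM v s t a : tact v (Mul s t) a = tact v s (tact v t a).
Proof. by []. Qed.
Lemma tactC v c a : tact v (Cst c) a = c *: a.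
Proof. by []. Qed.
Definition tactE := (tactD, tactM, tactC).

Variable v : G -> A -> A.
Hypothesis v_linear : forall x, linear (v x).

Lemma tact_linear t : linear (tact v t).
Proof.
elim: t => [x|c|s IHs t IHt|s IHs t IHt] //= d a b.
- by rewrite scalerDr !scalerA mulrC.
- by rewrite IHs IHt scalerDr addrACA.
- by rewrite IHt IHs.
Qed.

Lemma tact_exp t N a : tact v (iter N (Mul t) (Cst 1)) a = iter N (tact v t) a.
Proof. by elim: N => [|N IH] /=; rewrite ?scale1r ?IH. Qed.

Variable P : augpres k G.
Hypothesis v_rel : forall s t, ap_rel P s t -> tact v s =1 tact v t.

Lemma tact_pres_eq s t : pres_eq (ap_rel P) s t -> tact v s =1 tact v t.
Proof.
elim=> {s t} /=.
- exact: v_rel.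
- by [].
- by move=> s t _ IH a; rewrite IH.
- by move=> s t u _ IH1 _ IH2 a; rewrite IH1 IH2.
- by move=> s s' t t' _ IH1 _ IH2 a; rewrite IH1 IH2.
- by move=> s s' t t' _ IH1 _ IH2 a; rewrite IH2 IH1.
- by move=> s t u a; rewrite addrA.
- by move=> s t a; rewrite addrC.
- by move=> s a; rewrite scale0r add0r.
- by move=> s a; rewrite scaleN1r addNr scale0r.
- by [].
- by move=> s a; rewrite scale1r.
- by [].
- by move=> s t u a; rewrite (linD (tact_linear s)).
- by move=> c s a; rewrite (linZ (tact_linear s)).
- by move=> c d a; rewrite scalerDl.
- by move=> c d a; rewrite scalerA.
Qed.

Definition pact (u : palg P) : A -> A := tact v (repr u).

Lemma pactE t : pact (pcls P t) =1 tact v t.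
Proof. exact/tact_pres_eq/pcls_repr. Qed.

Lemma pact_linear u : linear (pact u).
Proof. exact: tact_linear. Qed.

Lemma pactDl u u' a : pact (u + u') a = pact u a + pact u' a.
Proof.
by elim/pcls_ind: u => s; elim/pcls_ind: u' => t; rewrite -pclsD !pactE.
Qed.

Lemma pactZl c u a : pact (c *: u) a = c *: pact u a.
Proof. by elim/pcls_ind: u => s; rewrite -pclsZ !pactE. Qed.

Lemma pactM u u' a : pact (u * u') a = pact u (pact u' a).
Proof.
by elim/pcls_ind: u => s; elim/pcls_ind: u' => t; rewrite -pclsM !pactE.
Qed.

Lemma pact1 a : pact 1 a = a.
Proof. by rewrite -pcls1 pactE /= scale1r. Qed.

Lemma pact_aug (e : A) : (forall x, v x e = ap_eps P x *: e) ->
  forall u, pact u e = paug u *: e.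
Proof.
move=> ve; elim/pcls_ind=> t; rewrite pactE paugE.
elim: t => [x|c|s IHs t IHt|s IHs t IHt] //=; first by rewrite IHs IHt scalerDl.
by rewrite IHt (linZ (tact_linear s)) IHs scalerA mulrC.
Qed.

End PresentedAction.

(** * Recursions for q-numbers and q-binomials *)

Section QNumbers.
Variable k : fieldType.
Local Notation fct r := (\prod_(i < r) ('X^(i.+1) - 1) : {poly k}).

Lemma fctS r : fct r.+1 = fct r * ('X^(r.+1) - 1).
Proof. by rewrite big_ord_recr. Qed.

(** The recursions are proved for polynomials, where the factors X^i - 1 are not zero
    divisors, and evaluated afterwards; at q^2 itself these factors may vanish. *)
Lemma gauss_upl a b :
  ('X^(a.+1) - 1) * gauss k (a.+1 + b) a.+1 = ('X^((a + b).+1) - 1) * gauss k (a + b) a.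
Proof.
apply: (mulIf (mulf_neq0 (fct_neq0 k a) (fct_neq0 k b))).
transitivity (fct (a + b).+1).
  by rewrite -addSn -(gaussE k a.+1 b) fctS; ring.
by rewrite fctS -(gaussE k a b); ring.
Qed.

Lemma gauss_upr a b :
  ('X^(b.+1) - 1) * gauss k (a + b.+1) a = ('X^((a + b).+1) - 1) * gauss k (a + b) a.
Proof.
apply: (mulIf (mulf_neq0 (fct_neq0 k a) (fct_neq0 k b))).
transitivity (fct (a + b).+1).
  by rewrite -addnS -(gaussE k a b.+1) fctS; ring.
by rewrite fctS -(gaussE k a b); ring.
Qed.

Lemma gauss_pascal1 a b : gauss k (a.+1 + b.+1) a.+1 =
  'X^(b.+1) * gauss k (a + b.+1) a + gauss k (a.+1 + b) a.+1.
Proof.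
have X0 : 'X^((a + b.+1).+1) = 'X^(a.+1) * 'X^(b.+1) :> {poly k}.
  by rewrite -exprD addSn.
apply: (mulIf (mulf_neq0 (fct_neq0 k a.+1) (fct_neq0 k b.+1))).
transitivity (fct (a + b.+1).+1); first by rewrite -addSn -(gaussE k a.+1 b.+1); ring.
rewrite fctS X0 mulrDl; set F := fct _.
transitivity ('X^(b.+1) * ('X^(a.+1) - 1) * F + ('X^(b.+1) - 1) * F); first by ring.
congr (_ + _); first by rewrite /F -(gaussE k a b.+1) [fct a.+1]fctS; ring.
by rewrite /F addnS -addSn -(gaussE k a.+1 b) [fct b.+1]fctS; ring.
Qed.

Lemma gauss_pascal2 a b : gauss k (a.+1 + b.+1) a.+1 =
  gauss k (a + b.+1) a + 'X^(a.+1) * gauss k (a.+1 + b) a.+1.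
Proof.
have X0 : 'X^((a + b.+1).+1) = 'X^(a.+1) * 'X^(b.+1) :> {poly k}.
  by rewrite -exprD addSn.
apply: (mulIf (mulf_neq0 (fct_neq0 k a.+1) (fct_neq0 k b.+1))).
transitivity (fct (a + b.+1).+1); first by rewrite -addSn -(gaussE k a.+1 b.+1); ring.
rewrite fctS X0 mulrDl; set F := fct _.
transitivity (('X^(a.+1) - 1) * F + 'X^(a.+1) * ('X^(b.+1) - 1) * F); first by ring.
congr (_ + _); first by rewrite /F -(gaussE k a b.+1) [fct a.+1]fctS; ring.
by rewrite /F addnS -addSn -(gaussE k a.+1 b) [fct b.+1]fctS; ring.
Qed.

Variable q : k.
Hypothesis q0 : q != 0.

Lemma qnum0 : qnum q 0 = 0.
Proof. by rewrite /qnum expr0 invr1 subrr mul0r. Qed.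

Lemma qnumE v : qnum q v = q ^- v * ((q ^+ 2) ^+ v - 1) / (q - q^-1).
Proof.
rewrite /qnum; congr (_ / _); rewrite mulrBr mulr1; congr (_ - _).
by rewrite -exprM mulnC exprM expr2 mulrA mulVf ?mul1r // expf_neq0.
Qed.

Lemma qbin_upl a b :
  qnum q a.+1 * qbin q (a.+1 + b) a.+1 = qnum q (a + b).+1 * qbin q (a + b) a.
Proof.
have G := congr1 (horner^~ (q ^+ 2)) (gauss_upl a b); rewrite /= !hornerE in G.
have E : q ^- a.+1 * q ^- (a.+1 * b) = q ^- (a + b).+1 * q ^- (a * b).
  by rewrite -!invfM -!exprD; congr (_ ^+ _)^-1; lia.
rewrite !qnumE /qbin !addKn; set d := (_ - _)^-1.
rewrite [LHS](_ : _ = (q ^- a.+1 * q ^- (a.+1 * b)) *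
  (((q ^+ 2) ^+ a.+1 - 1) * (gauss k (a.+1 + b) a.+1).[q ^+ 2]) * d); last by ring.
by rewrite E G; ring.
Qed.

Lemma qbin_upr a b :
  qnum q b.+1 * qbin q (a + b.+1) a = qnum q (a + b).+1 * qbin q (a + b) a.
Proof.
have G := congr1 (horner^~ (q ^+ 2)) (gauss_upr a b); rewrite /= !hornerE in G.
have E : q ^- b.+1 * q ^- (a * b.+1) = q ^- (a + b).+1 * q ^- (a * b).
  by rewrite -!invfM -!exprD; congr (_ ^+ _)^-1; lia.
rewrite !qnumE /qbin !addKn; set d := (_ - _)^-1.
rewrite [LHS](_ : _ = (q ^- b.+1 * q ^- (a * b.+1)) *
  (((q ^+ 2) ^+ b.+1 - 1) * (gauss k (a + b.+1) a).[q ^+ 2]) * d); last by ring.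
by rewrite E G; ring.
Qed.

(** This form of the q-Pascal rule enters the coproduct of E_j, the next one that of
    F_j. *)
Lemma qbin_pascal1 a b : qbin q (a.+1 + b.+1) a.+1 =
  q ^+ b.+1 * qbin q (a + b.+1) a + q ^- a.+1 * qbin q (a.+1 + b) a.+1.
Proof.
have := congr1 (horner^~ (q ^+ 2)) (gauss_pascal1 a b).
rewrite /= !hornerE /qbin !addKn => ->; rewrite mulrDr !mulrA.
have -> : q ^- (a.+1 * b.+1) * (q ^+ 2) ^+ b.+1 = q ^+ b.+1 * q ^- (a * b.+1).
  by rewrite -exprM mul2n -addnn mulSn !exprD; field; rewrite !expf_neq0.
have -> // : q ^- (a.+1 * b.+1) = q ^- a.+1 * q ^- (a.+1 * b).
by rewrite -invfM -exprD -mulnS.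
Qed.

Lemma qbin_pascal2 a b : qbin q (a.+1 + b.+1) a.+1 =
  q ^- b.+1 * qbin q (a + b.+1) a + q ^+ a.+1 * qbin q (a.+1 + b) a.+1.
Proof.
have := congr1 (horner^~ (q ^+ 2)) (gauss_pascal2 a b).
rewrite /= !hornerE /qbin !addKn => ->; rewrite mulrDr !mulrA.
have -> : q ^- (a.+1 * b.+1) * (q ^+ 2) ^+ a.+1 = q ^+ a.+1 * q ^- (a.+1 * b).
  by rewrite -exprM mul2n -addnn mulnS !exprD; field; rewrite !expf_neq0.
have -> // : q ^- (a.+1 * b.+1) = q ^- b.+1 * q ^- (a * b.+1).
by rewrite -invfM -exprD -mulSn.
Qed.

Hypothesis q21 : q ^+ 2 != 1.

Lemma q_sub_inv_neq0 : q - q^-1 != 0.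
Proof.
rewrite subr_eq0; apply: contraNneq q21 => e.
by rewrite expr2 {2}e divff.
Qed.

Lemma qnum1 : qnum q 1 = 1.
Proof. by rewrite /qnum expr1 divff ?q_sub_inv_neq0. Qed.

Lemma qnum_rec v : qnum q v + qnum q v.+2 = (q + q^-1) * qnum q v.+1.
Proof.
have := q_sub_inv_neq0; rewrite /qnum !exprS => d0.
have qv0 : q ^+ v != 0 by rewrite expf_neq0.
rewrite -mulrDl [RHS]mulrA; congr (_ * _); field.
by rewrite qv0.
Qed.

Lemma qnum2 : qnum q 2 = q + q^-1.
Proof. by have := qnum_rec 0; rewrite qnum0 qnum1 add0r mulr1. Qed.

Lemma qnum_eq0_expr l : qnum q l = 0 -> q ^+ (2 * l) = 1.
Proof.
move/eqP; rewrite /qnum mulf_eq0 invr_eq0 (negPf q_sub_inv_neq0) orbF subr_eq0.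
by rewrite mul2n -addnn exprD => /eqP {1}->; rewrite mulVf // expf_neq0.
Qed.

End QNumbers.

(** * Exponents as functions on the index set *)

Section Sites.
Variables m n : nat.
Implicit Types (x y : oidx m n) (i j : 'I_(m + n)) (v w : nat).

Definition val_at x i : nat :=
  match split i with inl a => x.1 a | inr b => x.2 b end.

(** At an index of I_0 every positive value is stored as 1, which is why the lemmas
    below assume that the value [fits]. *)
Definition put_at x i v : oidx m n :=
  match split i with
  | inl a => (mu_set x.1 a (0 < v)%N, x.2)
  | inr b => (x.1, [ffun c => if c == b then v else x.2 c])
  end.

Definition fits i v : bool := (i < m)%N ==> (v <= 1)%N.

Lemma fits_val x i : fits i (val_at x i).
Proof. by rewrite /fits /val_at; case: split_ordP => // a _; case: (x.1 a). Qed.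

Lemma val_put x i v j : fits i v ->
  val_at (put_at x i v) j = if j == i then v else val_at x j.
Proof.
rewrite /fits /val_at /put_at.
case: (split_ordP i) => [a ->|b ->]; case: (split_ordP j) => [c ->|d ->];
  rewrite eq_shift ?ffunE //=.
by case: eqP => // _; case: v => [|[|]].
Qed.

Lemma val_put_neq x i v j : j != i -> val_at (put_at x i v) j = val_at x j.
Proof.
rewrite /val_at /put_at.
by case: (split_ordP i) => [a ->|b ->]; case: (split_ordP j) => [c ->|d ->];
  rewrite eq_shift ?ffunE => //= /negPf->.
Qed.

Lemma val_put_same x i v : fits i v -> val_at (put_at x i v) i = v.
Proof. by move=> fv; rewrite val_put // eqxx. Qed.

Lemma idx_ext x y : (forall i, val_at x i = val_at y i) -> x = y.
Proof.
case: x y => [x1 x2] [y1 y2] e; congr pair; apply/ffunP => a.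
  have := e (lshift n a); rewrite /val_at (unsplitK (inl a)) /=.
  by case: (x1 a) (y1 a) => [] [].
by have := e (rshift m a); rewrite /val_at (unsplitK (inr a)).
Qed.

Lemma put_put x i v w : put_at (put_at x i v) i w = put_at x i w.
Proof.
rewrite /put_at; case: split => a /=; congr pair; apply/ffunP => c;
  by rewrite !ffunE; case: eqP.
Qed.

Lemma put_val x i : put_at x i (val_at x i) = x.
Proof.
apply: idx_ext => j; rewrite val_put ?fits_val //.
by case: eqP => // ->.
Qed.

Lemma put_comm x i j v w : i != j ->
  put_at (put_at x i v) j w = put_at (put_at x j w) i v.
Proof.
rewrite /put_at.
case: (split_ordP i) => [a ->|b ->]; case: (split_ordP j) => [c ->|d ->] //=;
  rewrite eq_shift => /eqP ne; congr pair; apply/ffunP => e; rewrite !ffunE;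
  do 2 case: eqP => // ?; congruence.
Qed.

Lemma star_vec1_fermi i (al : {ffun 'I_n -> nat}) : (i < m)%N ->
  star (evec i) (vec1 m al) = 0%N.
Proof.
move=> im; apply: big1 => l _; apply: big1 => j jl; rewrite /evec /vec1.
case: eqP => // e; move: jl; rewrite -e => ji.
by case: split_ordP => // b ej; move: ji; rewrite ej /=; lia.
Qed.

End Sites.

(** * Raising and lowering operators *)

Section Ladders.
Variables (k : fieldType) (q : k) (m n : nat).
Local Notation idx := (oidx m n).

(** An algebra V with a basis xb, described by linear extension from the basis and
    its uniqueness. *)
Variables (V : algType k) (xb : idx -> V).
Variable linext : (idx -> V) -> {linear V -> V}.
Hypothesis linextE : forall f x, linext f (xb x) = f x.
Hypothesis xb_ext : forall f h : V -> V, linear f -> linear h ->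
  (forall x, f (xb x) = h (xb x)) -> f =1 h.

Implicit Types (x y : idx) (i j : 'I_(m + n)) (v w : nat) (a b : V) (s : bool).

Lemma eq_on_xb (f h : {linear V -> V}) : (forall x, f (xb x) = h (xb x)) -> f =1 h.
Proof. by apply: xb_ext; apply: linearP. Qed.

Definition diag (f : idx -> k) : {linear V -> V} := linext (fun x => f x *: xb x).

Lemma diag_xb f x : diag f (xb x) = f x *: xb x.
Proof. by rewrite /diag linextE. Qed.

(** The boolean is true for raising and false for lowering, throughout. *)
Definition ladder_coef s i v : k :=
  if s then if (i < m)%N then (v == 0)%:R else qnum q v.+1 else (v != 0)%:R.

Definition step s v : nat := if s then v.+1 else v.-1.

Definition ladder s i : {linear V -> V} := linext (fun x =>
  ladder_coef s i (val_at x i) *: xb (put_at x i (step s (val_at x i)))).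

Lemma ladder_xb s i x : ladder s i (xb x) =
  ladder_coef s i (val_at x i) *: xb (put_at x i (step s (val_at x i))).
Proof. by rewrite /ladder linextE. Qed.

Lemma ladderZ s i c a : ladder s i (c *: a) = c *: ladder s i a.
Proof. exact: linearZ. Qed.

Lemma ladder_put s i x v : fits i v ->
  ladder s i (xb (put_at x i v)) = ladder_coef s i v *: xb (put_at x i (step s v)).
Proof. by move=> fv; rewrite ladder_xb put_put val_put_same. Qed.

Lemma fits_step s i v : fits i v -> ladder_coef s i v != 0 -> fits i (step s v).
Proof.
rewrite /fits /ladder_coef; case: (i < m)%N => //=.
by case: s v => [] [|[|]] //=; rewrite eqxx.
Qed.

Lemma ladder_comm s s' i j a : (i != j) || (s == s') ->
  ladder s i (ladder s' j a) = ladder s' j (ladder s i a).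
Proof.
have [->|neij] /= := eqVneq i j; first by move/eqP->.
move=> _; have neji : j != i by rewrite eq_sym.
apply: (eq_on_xb (f := ladder s i \o ladder s' j) (h := ladder s' j \o ladder s i)) => x /=.
rewrite !ladder_xb !linearZ /= !ladder_xb (val_put_neq _ _ neij) (val_put_neq _ _ neji).
by rewrite !scalerA mulrC put_comm.
Qed.

Hypotheses (q0 : q != 0) (q21 : q ^+ 2 != 1).

(** Exponents in I_0 are 0 or 1, so neither raising nor lowering can occur twice. *)
Lemma ladder_fermi s i a : (i < m)%N -> ladder s i (ladder s i a) = 0.
Proof.
move=> im; apply: (eq_on_xb (f := ladder s i \o ladder s i) (h := \0)) => x /=.
rewrite -(put_val x i); move: (val_at x i) (fits_val x i) => v fv.
rewrite ladder_put // linearZ /=; have [->|nz] := eqVneq (ladder_coef s i v) 0.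
  by rewrite scale0r.
rewrite ladder_put ?fits_step // scalerA.
move: fv nz; rewrite /fits /ladder_coef im /=.
by case: s v => [] [|[|]] //= _; rewrite ?eqxx // mulr0 scale0r.
Qed.

(** On an exponent v the three terms carry consecutive q-numbers times a common
    factor, so this is the recursion [qnum_rec].  It is the core of the Serre
    relations. *)
Lemma ladder_bose s i a : (m <= i)%N ->
  ladder s i (ladder s i (ladder (~~ s) i a)) +
    ladder (~~ s) i (ladder s i (ladder s i a)) =
  (q + q^-1) *: ladder s i (ladder (~~ s) i (ladder s i a)).
Proof.
move=> mi.
pose L := ladder s i; pose L' := ladder (~~ s) i.
apply: (eq_on_xb (f := (L \o (L \o L')) \+ (L' \o (L \o L)))
                 (h := (q + q^-1) \*: (L \o (L' \o L)))) => x.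
rewrite /= /L /L'.
have fI v : fits i v by rewrite /fits ltnNge mi.
rewrite -(put_val x i); move: (val_at x i) => v.
have LP s' w : ladder s' i (xb (put_at x i w)) = _ := ladder_put s' x (fI w).
rewrite !(LP, ladderZ) !scalerA /ladder_coef ltnNge mi /=.
case: s {L L'} => /=.
  case: v => [|v] /=; rewrite !(mul0r, scale0r, add0r, mulr1, mul1r, (qnum1 q0 q21)).
    by rewrite (qnum2 q0 q21).
  rewrite -scalerDl; congr (_ *: _); rewrite -qnum_rec //; ring.
case: v => [|[|v]] /=; rewrite ?eqxx;
  rewrite !(mul0r, scale0r, add0r, mulr1, mul1r, (qnum1 q0 q21), mulr0).
- by [].
- by rewrite addr0 (qnum2 q0 q21).
by rewrite -scalerDl -qnum_rec // addrC.
Qed.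

(** Moving one unit of exponent from j to i if s is true, from i to j otherwise. *)
Definition hop s (i j : 'I_(m + n)) : {linear V -> V} := ladder s i \o ladder (~~ s) j.

(** The only pairs of ladder operators that fail to commute are a raising and a
    lowering at the same index. *)
Lemma hop_comm s t i j i' j' a :
    [&& (i != i') || (s == t), (i != j') || (s == ~~ t),
        (j != i') || (~~ s == t) & (j != j') || (s == t)] ->
  hop s i j (hop t i' j' a) = hop t i' j' (hop s i j a).
Proof.
case/and4P=> ii ij ji jj; rewrite /hop /=.
rewrite (ladder_comm _ ji) (ladder_comm _ ii) (ladder_comm _ (i := j)).
  by rewrite (ladder_comm _ ij).
by case/orP: jj => [->|/eqP->]; rewrite ?eqxx ?orbT.
Qed.

(** Only the operators at the index j shared by the two hops fail to commute.  Once
    the other ones are moved to the left, the relation is [ladder_bose] at j if j is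
    in I_1, and contains the square of the operator at i if i is in I_0. *)
Lemma hop_serre_src s i j l a : i != j -> j != l -> i != l ->
    (i < m)%N || (m <= j)%N ->
  hop s i j (hop s i j (hop s j l a)) + hop s j l (hop s i j (hop s i j a)) =
  (q + q^-1) *: hop s i j (hop s j l (hop s i j a)).
Proof.
move=> ij jl il c; rewrite /hop /=.
have cA t b : ladder t j (ladder s i b) = ladder s i (ladder t j b).
  by rewrite ladder_comm // eq_sym ij.
have cLA b : ladder (~~ s) l (ladder s i b) = ladder s i (ladder (~~ s) l b).
  by rewrite ladder_comm // eq_sym il.
have cL t b : ladder t j (ladder (~~ s) l b) = ladder (~~ s) l (ladder t j b).
  by rewrite ladder_comm // jl.
rewrite !(cA, cLA, cL); case/orP: c => [im|mj].
  by rewrite !ladder_fermi // scaler0 addr0.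
have := ladder_bose (~~ s) (ladder (~~ s) l a) mj; rewrite negbK.
move/(congr1 (fun b => ladder s i (ladder s i b))).
by rewrite !linearD !linearZ /= !cL.
Qed.

(** As [hop_serre_src], with the repeated hop on the other side of the index j. *)
Lemma hop_serre_tgt s i j l a : i != j -> j != l -> i != l ->
    (l < m)%N || (m <= j)%N ->
  hop s j l (hop s j l (hop s i j a)) + hop s i j (hop s j l (hop s j l a)) =
  (q + q^-1) *: hop s j l (hop s i j (hop s j l a)).
Proof.
move=> ij jl il c; rewrite /hop /=.
have cA t b : ladder t j (ladder s i b) = ladder s i (ladder t j b).
  by rewrite ladder_comm // eq_sym ij.
have cLA b : ladder (~~ s) l (ladder s i b) = ladder s i (ladder (~~ s) l b).
  by rewrite ladder_comm // eq_sym il.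
have cL t b : ladder t j (ladder (~~ s) l b) = ladder (~~ s) l (ladder t j b).
  by rewrite ladder_comm // jl.
rewrite !(cA, cLA, cL); case/orP: c => [lm|mj].
  by rewrite !ladder_fermi // !linear0 addr0.
have := ladder_bose s a mj.
move/(congr1 (fun b => ladder s i (ladder (~~ s) l (ladder (~~ s) l b)))).
by rewrite !linearD !linearZ /=.
Qed.

(** The operators at i1 and i4 commute with all others.  At i2, in I_0, the first and
    fourth words contain a square and vanish, and the other three contain the same
    factor; at i3, in I_1, these three are the terms of [ladder_bose]. *)
Lemma hop_serre_odd s i1 i2 i3 i4 a :
    uniq [:: i1; i2; i3; i4] ->
    (i2 < m <= i3)%N ->
  let X := hop s i1 i2 in let Y := hop s i2 i3 in let Z := hop s i3 i4 in
  X (Y (Z (Y a))) + Y (X (Y (Z a))) + Z (Y (X (Y a))) + Y (Z (Y (X a))) =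
  (q + q^-1) *: Y (X (Z (Y a))).
Proof.
rewrite /= !inE !negb_or -!andbA => /and5P[n12 n13 n14 n23 /andP[n24]].
rewrite andbT => n34 c; rewrite /hop /=.
have c21 t b : ladder t i2 (ladder s i1 b) = ladder s i1 (ladder t i2 b).
  by rewrite ladder_comm // eq_sym n12.
have c31 t b : ladder t i3 (ladder s i1 b) = ladder s i1 (ladder t i3 b).
  by rewrite ladder_comm // eq_sym n13.
have c41 t b : ladder t i4 (ladder s i1 b) = ladder s i1 (ladder t i4 b).
  by rewrite ladder_comm // eq_sym n14.
have c24 t b : ladder t i2 (ladder (~~ s) i4 b) = ladder (~~ s) i4 (ladder t i2 b).
  by rewrite ladder_comm // n24.
have c34 t b : ladder t i3 (ladder (~~ s) i4 b) = ladder (~~ s) i4 (ladder t i3 b).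
  by rewrite ladder_comm // n34.
have c32 t u b : ladder t i3 (ladder u i2 b) = ladder u i2 (ladder t i3 b).
  by rewrite ladder_comm // eq_sym n23.
rewrite !(c21, c31, c41) !(c24, c34) !c32.
case/andP: c => i2m mi3.
rewrite !(ladder_fermi _ _ i2m) !linear0 add0r addr0.
have := ladder_bose (~~ s) a mi3; rewrite negbK.
move/(congr1 (fun b => ladder s i1 (ladder (~~ s) i4
  (ladder s i2 (ladder (~~ s) i2 (ladder s i2 b)))))).
by rewrite !linearD !linearZ.
Qed.

Lemma diag_ladder f (c : k) s i a :
    (forall x, ladder_coef s i (val_at x i) != 0 ->
       f (put_at x i (step s (val_at x i))) = c * f x) ->
  diag f (ladder s i a) = c *: ladder s i (diag f a).
Proof.
move=> fc.
apply: (eq_on_xb (f := diag f \o ladder s i) (h := c \*: (ladder s i \o diag f))) => x.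
rewrite /= diag_xb ladderZ ladder_xb linearZ /= diag_xb !scalerA.
have [->|nz] := eqVneq (ladder_coef s i (val_at x i)) 0; first by rewrite !(mulr0, mul0r).
by rewrite fc //; congr (_ *: _); ring.
Qed.

(** The eigenvalue of X_i D_i (s true) or D_i X_i (s false) on the exponent v. *)
Definition number s i v : k := ladder_coef (~~ s) i v * ladder_coef s i (step (~~ s) v).

Lemma ladder_number s i a :
  ladder s i (ladder (~~ s) i a) = diag (fun x => number s i (val_at x i)) a.
Proof.
apply: (eq_on_xb (f := ladder s i \o ladder (~~ s) i) (h := diag _)) => x.
rewrite /= diag_xb ladder_xb ladderZ /number.
have [->|nz] := eqVneq (ladder_coef (~~ s) i (val_at x i)) 0.
  by rewrite mul0r !scale0r.
rewrite ladder_put ?fits_step ?fits_val // scalerA; congr (_ *: xb _).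
rewrite -[RHS](put_val x i); congr put_at.
case: s nz => //=; rewrite /ladder_coef => nz; rewrite prednK // lt0n.
by apply: contraNneq nz => ->; rewrite eqxx.
Qed.

Lemma numberT i v : fits i v -> number true i v = if (i < m)%N then v%:R else qnum q v.
Proof.
rewrite /number /fits /ladder_coef /=.
by case: (i < m)%N v => [] [|[|v]] //= _; rewrite ?(mulr1, mul1r, mul0r) // qnum0.
Qed.

Lemma numberF i v : fits i v ->
  number false i v = if (i < m)%N then 1 - v%:R else qnum q v.+1.
Proof.
rewrite /number /fits /ladder_coef /=.
by case: (i < m)%N v => [] [|[|v]] //= _; rewrite ?(mulr1, mul1r, mul0r, subr0, subrr).
Qed.

Lemma hop_hop_number s i j a : i != j ->
  hop s i j (hop (~~ s) i j a) =
  diag (fun x => number s i (val_at x i) * number (~~ s) j (val_at x j)) a.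
Proof.
move=> ij; rewrite /hop /= negbK (ladder_comm _ (i := j)); last by rewrite eq_sym ij.
have := ladder_number (~~ s) j a; rewrite negbK => ->; rewrite ladder_number.
apply: (eq_on_xb (f := diag _ \o diag _) (h := diag _)) => x.
by rewrite /= !diag_xb linearZ /= diag_xb scalerA mulrC.
Qed.

(** * The action of the generators satisfies the relations *)

(** An eigenvalue f that is multiplied by c under a ladder step makes the diagonal
    operator of f commute with the ladder operator up to c ([diag_ladder]). *)
Definition shifted (f : idx -> k) (c : k) s i := forall x,
  ladder_coef s i (val_at x i) != 0 -> f (put_at x i (step s (val_at x i))) = c * f x.

Lemma shiftedM f h c d s i : shifted f c s i -> shifted h d s i ->
  shifted (fun x => f x * h x) (c * d) s i.
Proof. by move=> fc hd x nz; rewrite fc // hd // mulrACA. Qed.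

Lemma shiftedV f c s i : shifted f c s i ->
  shifted (fun x => (f x)^-1) c^-1 s i.
Proof. by move=> fc x nz; rewrite fc // invfM. Qed.

Lemma diag_hop f c d s i j a : shifted f c s i -> shifted f d (~~ s) j ->
  diag f (hop s i j a) = (c * d) *: hop s i j (diag f a).
Proof.
by move=> fc fd; rewrite /hop /= (diag_ladder _ fc) (diag_ladder _ fd) ladderZ scalerA.
Qed.

Lemma diagM f h a : diag f (diag h a) = diag (fun x => f x * h x) a.
Proof.
apply: (eq_on_xb (f := diag f \o diag h) (h := diag _)) => x.
by rewrite /= !diag_xb linearZ /= diag_xb scalerA mulrC.
Qed.

Lemma eq_diag f h a : f =1 h -> diag f a = diag h a.
Proof.
by move=> e; apply: (eq_on_xb (f := diag f) (h := diag h)) => x; rewrite !diag_xb e.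
Qed.

Lemma diag1 a : diag (fun=> 1) a = a.
Proof. by apply: (eq_on_xb (f := diag _) (h := idfun)) => x; rewrite diag_xb scale1r. Qed.

Lemma sigma_valE i x : sigma_val q i x = qq q i ^+ val_at x i.
Proof.
by rewrite /sigma_val /qq /val_at; case: split_ordP => // b _; rewrite exprVn.
Qed.

Lemma qq_neq0 i : qq q i != 0.
Proof. by rewrite /qq; case: ifP; rewrite ?invr_eq0. Qed.

Lemma sigma_neq0 i x : sigma_val q i x != 0.
Proof. by rewrite sigma_valE expf_neq0 // qq_neq0. Qed.

Definition site_weight s i j : k :=
  if i == j then if s then qq q i else (qq q i)^-1 else 1.

Lemma shifted_sigma s i j :
  shifted (sigma_val q i)
    (site_weight s i j) s j.
Proof.
move=> x nz; rewrite /site_weight !sigma_valE; case: eqVneq => [->|ne].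
  rewrite val_put_same ?fits_step ?fits_val //.
  case: s nz => nz; first by rewrite /= exprS.
  move: nz; case: (val_at x j) => [|v] /=; first by rewrite eqxx.
  by rewrite exprS mulrA mulVf ?qq_neq0 ?mul1r.
by rewrite val_put_neq // mul1r.
Qed.

(** E_j for s true, F_j for s false. *)
Definition root_op s (j : 'I_(m + n).-1) : {linear V -> V} := hop s (lo j) (hi j).

Lemma lo_neq_hi (j : 'I_(m + n).-1) : lo j != hi j.
Proof. by rewrite -val_eqE /= ltn_eqF. Qed.

Lemma site_weight_hop s i (j : 'I_(m + n).-1) :
  site_weight s i (lo j) * site_weight (~~ s) i (hi j) =
  if s then gl_weight q i j else (gl_weight q i j)^-1.
Proof.
rewrite /gl_weight /site_weight.
have [->|nlo] := eqVneq i (lo j).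
  rewrite (negPf (lo_neq_hi j)) mulr1 subr0 expr1z.
  by case: s.
have [_|_] := eqVneq i (hi j); last by rewrite mulr1 subrr expr0z invr1 if_same.
by rewrite mul1r sub0r exprN1; case: s; rewrite ?invrK.
Qed.

Variable g : gtype.

Definition torus_val : torus g m n -> idx -> k :=
  match g return torus g m n -> idx -> k with
  | GL => fun t x => sigma_val q t x
  | SL => fun t x => sigma_val q (lo t) x / sigma_val q (hi t) x
  end.

Lemma torus_val_neq0 t x : torus_val t x != 0.
Proof.
rewrite /torus_val; case: g t => t; first exact: sigma_neq0.
by rewrite mulf_neq0 ?invr_eq0 ?sigma_neq0.
Qed.

Lemma diag_torus_val_root_op s t (j : 'I_(m + n).-1) a :
  diag (torus_val t) (root_op s j a) =
  (if s then weight q t j else (weight q t j)^-1) *: root_op s j (diag (torus_val t) a).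
Proof.
rewrite /torus_val /weight; case: g t => t.
  rewrite (diag_hop _ (@shifted_sigma s t _) (@shifted_sigma (~~ s) t _)).
  by rewrite site_weight_hop.
pose S s' u i' :=
  shiftedM (@shifted_sigma s' (lo u) i') (shiftedV (@shifted_sigma s' (hi u) i')).
rewrite (diag_hop _ (S s t (lo j)) (S (~~ s) t (hi j))); congr (_ *: _).
rewrite mulrACA -invfM !site_weight_hop.
by case: s; rewrite // invfM invrK.
Qed.

Definition al_sign x : k := (-1) ^+ (\sum_(b < n) x.2 b)%N.

(** Only the steps in I_1 change |alpha|; hence E_j and F_j change its parity exactly
    for j = m. *)
Lemma shifted_al_sign s i :
  shifted al_sign (if (i < m)%N then 1 else -1) s i.
Proof.
move=> x; rewrite /al_sign /put_at /ladder_coef /val_at.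
case: split_ordP => [b _ _|b _] /=; first by rewrite mul1r.
rewrite [X in _ -> (-1) ^+ X = _](bigD1 b) // [X in _ -> _ = _ * (-1) ^+ X](bigD1 b) //=.
rewrite ffunE eqxx (eq_bigr x.2); last by move=> c /negPf nc; rewrite ffunE nc.
rewrite !exprD mulrA; case: s => [_|] /=; first by rewrite exprS.
by case: (x.2 b) => [|v]; rewrite ?eqxx //= exprS mulrA mulrNN mulr1 mul1r.
Qed.

Lemma diag_al_sign_root_op s (j : 'I_(m + n).-1) a :
  diag al_sign (root_op s j a) = (-1) ^+ parity j *: root_op s j (diag al_sign a).
Proof.
rewrite (diag_hop _ (@shifted_al_sign s (lo j)) (@shifted_al_sign (~~ s) (hi j))).
congr (_ *: _); rewrite /parity /=.
case: (ltngtP j.+1 m) => [jm|mj|jm].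
- by rewrite mulr1.
- by rewrite mulrNN mulr1.
by rewrite mul1r.
Qed.

Definition cartan_val (j : 'I_(m + n).-1) x : k :=
  sigma_val q (lo j) x / sigma_val q (hi j) x.

(** Both products are diagonal by [hop_hop_number].  With v, w the exponents at j and
    j + 1, the identity of eigenvalues is v - w = [v - w] for v, w at most 1 if
    j < m, [v + w] if j = m, and [v][w+1] - [v+1][w] = [v - w] if j > m. *)
Lemma root_op_EF_same (j : 'I_(m + n).-1) a :
  root_op true j (root_op false j a) -
    (-1) ^+ parity j *: root_op false j (root_op true j a) =
  (qq q (lo j) - (qq q (lo j))^-1)^-1 *:
    (diag (cartan_val j) a - diag (fun x => (cartan_val j x)^-1) a).
Proof.
rewrite /root_op (hop_hop_number true _ (lo_neq_hi j)).
rewrite (hop_hop_number false _ (lo_neq_hi j)).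
apply: (eq_on_xb (f := diag _ \- _ \*: diag _) (h := _ \*: (diag _ \- diag _))) => x.
rewrite /= !diag_xb -scalerBl !scalerA -scalerBl; congr (_ *: _).
rewrite /cartan_val !sigma_valE !numberT ?numberF ?fits_val //.
move: (fits_val x (lo j)) (fits_val x (hi j)); rewrite /fits /parity /qq /=.
move: (val_at x (lo j)) (val_at x (hi j)) => v w.
have qv0 : q ^+ v != 0 by rewrite expf_neq0.
have qw0 : q ^+ w != 0 by rewrite expf_neq0.
have d1 : q * q - 1 != 0 by rewrite -expr2 subr_eq0.
have d2 : 1 - q * q != 0 by rewrite -opprB oppr_eq0.
case: (ltngtP j.+1 m) => [jm|mj|jm] /=; rewrite ?expr1 ?expr0 ?mul1r ?mulN1r.
- by case: v w {qv0 qw0} => [|[|//]] [|[|//]] _ _; rewrite /= ?expr1 ?expr0;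
    field; rewrite oner_eq0 q0 d1.
- move=> _ _; rewrite !exprVn /qnum !exprS; field.
  by rewrite mulNr oner_eq0 d1 d2 q0 qv0 qw0.
by case: v {qv0} => [|[|//]] _ _; rewrite /= ?expr1 ?expr0 exprVn /qnum ?exprS;
  field; rewrite ?oner_eq0 q0 qw0 d1.
Qed.

Definition gen_op (x : gen g m n) : {linear V -> V} :=
  match x with
  | genE j => root_op true j
  | genF j => root_op false j
  | genK t => diag (torus_val t)
  | genKV t => diag (fun x => (torus_val t x)^-1)
  | genS => diag al_sign
  end.

Local Notation act := (tact (fun x : gen g m n => gen_op x)).

Lemma act_tX s (j : 'I_(m + n).-1) a : act (tX k g s j) a = root_op s j a.
Proof. by case: s. Qed.

Lemma act_tE (j : 'I_(m + n).-1) a : act (tE k g j) a = root_op true j a.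
Proof. by []. Qed.
Lemma act_tF (j : 'I_(m + n).-1) a : act (tF k g j) a = root_op false j a.
Proof. by []. Qed.
Lemma act_tK t a : act (tK k t) a = diag (torus_val t) a.
Proof. by []. Qed.
Lemma act_tKV t a : act (tKV k t) a = diag (fun x => (torus_val t x)^-1) a.
Proof. by []. Qed.
Lemma act_tS a : act (tS k m n g) a = diag al_sign a.
Proof. by []. Qed.
Definition actE := (tactE, act_tX, act_tE, act_tF, act_tK, act_tKV, act_tS).

Lemma act_tcK (j : 'I_(m + n).-1) a : act (tcK k g j) a = diag (cartan_val j) a.
Proof.
rewrite /tcK /cartan /tK /tKV /gen_op /torus_val; case: g => //=.
by rewrite diagM.
Qed.

Lemma act_tcKV (j : 'I_(m + n).-1) a :
  act (tcKV k g j) a = diag (fun x => (cartan_val j x)^-1) a.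
Proof.
rewrite /tcKV /cartan /tK /tKV /gen_op /torus_val; case: g => //=.
by rewrite diagM; apply: eq_diag => x; rewrite /cartan_val invfM invrK.
Qed.

Lemma root_op_comm s (i j : 'I_(m + n).-1) a : (i.+1 < j)%N || (j.+1 < i)%N ->
  root_op s i (root_op s j a) = root_op s j (root_op s i a).
Proof.
move=> far; apply: hop_comm; apply/and4P.
by split; rewrite ?eqxx ?orbT //; apply/orP; left; rewrite -val_eqE /=; lia.
Qed.

Lemma root_op_EF_diff (i j : 'I_(m + n).-1) a : i != j ->
  root_op true i (root_op false j a) = root_op false j (root_op true i a).
Proof.
by move=> ij; apply: hop_comm; apply/and4P; split; rewrite ?orbT ?orbF.
Qed.

Lemma root_op_serre s (i j : 'I_(m + n).-1) a : (i.+1 == j)%N || (j.+1 == i)%N ->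
    ~~ parity i ->
  root_op s i (root_op s i (root_op s j a)) + root_op s j (root_op s i (root_op s i a)) =
  (q + q^-1) *: root_op s i (root_op s j (root_op s i a)).
Proof.
rewrite /parity => near iodd.
have c : (i < m)%N && (i.+1 < m)%N || (m <= i)%N && (m <= i.+1)%N.
  by move: iodd; case: ltngtP; lia.
case/orP: near => /eqP e.
  have hl : hi i = lo j by apply: val_inj.
  rewrite /root_op -hl; apply: hop_serre_src; rewrite -?hl -?val_eqE /=; lia.
have hl : hi j = lo i by apply: val_inj.
rewrite /root_op -hl; apply: hop_serre_tgt; rewrite ?hl -?val_eqE /=; lia.
Qed.

Lemma root_op_fermi s (i : 'I_(m + n).-1) a : parity i -> root_op s i (root_op s i a) = 0.
Proof.
move=> /eqP im; rewrite /root_op /hop /= (ladder_comm _ (i := hi i)).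
  by rewrite ladder_fermi //=; lia.
by rewrite eq_sym lo_neq_hi.
Qed.

Lemma root_op_serre_odd s (i j l : 'I_(m + n).-1) a :
    i.+1 = j :> nat -> j.+1 = l :> nat -> parity j ->
  root_op s i (root_op s j (root_op s l (root_op s j a))) +
  root_op s j (root_op s i (root_op s j (root_op s l a))) +
  root_op s l (root_op s j (root_op s i (root_op s j a))) +
  root_op s j (root_op s l (root_op s j (root_op s i a))) =
  (q + q^-1) *: root_op s j (root_op s i (root_op s l (root_op s j a))).
Proof.
move=> ij jl /eqP jm.
have hij : hi i = lo j by apply: val_inj.
have hjl : hi j = lo l by apply: val_inj.
rewrite /root_op hij hjl; apply: hop_serre_odd; last by move=> /=; lia.
by rewrite /= !inE -!val_eqE /=; lia.
Qed.

Variable r : option nat.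

(** In the restricted case the properties of l travel with the exponents: [l] = 0
    keeps the operators in range, and 2 < l bounds the exponents in I_0 by l. *)
Definition in_range x : Prop :=
  if r is Some l then restricted_at q l /\ al_below l x.2 else True.

Lemma val_lt_level l x i : r = Some l -> in_range x -> (val_at x i < l)%N.
Proof.
rewrite /in_range /val_at => -> [[_ l2] /forallP below].
by case: split => // b; case: (x.1 b) => //=; apply: ltn_trans l2.
Qed.

Lemma iter_lower i N x : (val_at x i < N)%N -> iter N (ladder false i) (xb x) = 0.
Proof.
elim: N x => // N IH x; rewrite iterSr ladder_xb.
have it0 c a : iter N (ladder false i) (c *: a) = c *: iter N (ladder false i) a.
  by elim: N {IH} => //= N ->; rewrite ladderZ.
rewrite it0; case e: (val_at x i) => [|v] /=; first by rewrite scale0r.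
rewrite ltnS => vN; rewrite IH ?scaler0 // val_put_same //.
by have := fits_val x i; rewrite /fits e; case: (i < m)%N => //= /ltnW.
Qed.

Lemma iter_ladder_comm s t i j N N' a : i != j ->
  iter N (ladder s i) (iter N' (ladder t j) a) =
  iter N' (ladder t j) (iter N (ladder s i) a).
Proof.
move=> ij; have c b : iter N (ladder s i) (ladder t j b) = ladder t j (iter N (ladder s i) b).
  by elim: N => //= N ->; rewrite ladder_comm // ij.
by elim: N' => //= N' IH; rewrite c IH.
Qed.

Lemma iter_hop s i j N a : i != j ->
  iter N (hop s i j) a = iter N (ladder s i) (iter N (ladder (~~ s) j) a).
Proof.
move=> ij; elim: N => //= N ->; congr (ladder s i _).
have ji : j != i by rewrite eq_sym.
exact: (iter_ladder_comm (~~ s) s 1 N _ ji).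
Qed.

Lemma iter_ladder0 s i N : iter N (ladder s i) 0 = 0.
Proof. by elim: N => //= N ->; rewrite linear0. Qed.

(** Whichever of E_j and F_j is taken, one of its two factors lowers an exponent, and
    an exponent smaller than l cannot be lowered l times. *)
Lemma root_op_nilpotent s (j : 'I_(m + n).-1) l x : r = Some l -> in_range x ->
  iter l (root_op s j) (xb x) = 0.
Proof.
move=> rE xr; rewrite /root_op iter_hop ?lo_neq_hi //.
case: s => /=; first by rewrite iter_lower ?iter_ladder0 // (val_lt_level _ rE).
rewrite iter_ladder_comm ?lo_neq_hi //.
by rewrite iter_lower ?iter_ladder0 // (val_lt_level _ rE).
Qed.

Lemma iter_diag f N a : iter N (diag f) a = diag (fun x => f x ^+ N) a.
Proof.
elim: N => [|N IH] /=; first by rewrite -[LHS]diag1; apply: eq_diag.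
by rewrite IH diagM; apply: eq_diag => x; rewrite exprS.
Qed.

Lemma torus_val_order l t x : restricted_at q l -> torus_val t x ^+ (2 * l) = 1.
Proof.
case=> + l2; case: l l2 => // l _ [/(qnum_eq0_expr q0 q21) ql _].
have s1 i : sigma_val q i x ^+ (2 * l.+1) = 1.
  rewrite sigma_valE -exprM mulnC exprM /qq; case: ifP => _.
    by rewrite ql expr1n.
  by rewrite exprVn ql invr1 expr1n.
by rewrite /torus_val; case: g t => t //; rewrite exprMn exprVn !s1 mul1r invr1.
Qed.

(** The two relations of the restricted algebra are the reason why x has to be in
    range. *)
Lemma gen_op_rel (T T' : term k (gen g m n)) x : uq_rel q r T T' ->
  in_range x -> act T (xb x) = act T' (xb x).
Proof.
case=> {T T'}.
- by move=> t u _; rewrite !actE !diagM; apply: eq_diag => y; rewrite mulrC.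
- move=> t _; rewrite !actE diagM scale1r -[RHS]diag1.
  by apply: eq_diag => y; rewrite divff ?torus_val_neq0.
- move=> t _; rewrite !actE diagM scale1r -[RHS]diag1.
  by apply: eq_diag => y; rewrite mulVf ?torus_val_neq0.
- by move=> t j _; rewrite !actE diag_torus_val_root_op.
- by move=> t j _; rewrite !actE diag_torus_val_root_op.
- move=> i j _; rewrite !actE act_tcK act_tcKV !scaleN1r.
  have [<-|ij] := eqVneq i j; first by rewrite mulnb andbb root_op_EF_same mul1r.
  rewrite root_op_EF_diff // mul0r scale0r mulnb.
  suff -> : parity i && parity j = false by rewrite scale1r subrr.
  apply: contraNF ij => /andP[/eqP pi /eqP pj].
  by apply/eqP/val_inj; apply: succn_inj; rewrite pi pj.
- by move=> b i j far _; rewrite !actE root_op_comm.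
- move=> b i j near even _; rewrite !actE scale0r scaleN1r.
  by rewrite addrAC root_op_serre // subrr.
- by move=> b i odd _; rewrite !actE root_op_fermi // scale0r.
- move=> b i j l ij jl odd _; rewrite !actE scale0r scaleN1r.
  by rewrite root_op_serre_odd // subrr.
- move=> _; rewrite !actE diagM scale1r -[RHS]diag1; apply: eq_diag => y.
  by rewrite /al_sign -expr2 sqrr_sign.
- move=> b j _; rewrite !actE diag_al_sign_root_op diagM; congr (_ *: root_op _ _ _).
  by rewrite -[RHS]diag1; apply: eq_diag => y; rewrite /al_sign -expr2 sqrr_sign.
- move=> t _; rewrite !actE !diagM; apply: eq_diag => y.
  by rewrite mulrC mulrA /al_sign -expr2 sqrr_sign mul1r.
- move=> b l i _ rE _ xr; rewrite tact_exp tactE scale0r -(root_op_nilpotent b i rE xr).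
  by apply: eq_iter => a; rewrite act_tX.
- move=> l t rE xr; rewrite tact_exp tactE scale1r.
  rewrite (eq_iter (f' := diag (torus_val t))) // iter_diag -[RHS]diag1.
  apply: eq_diag => y; rewrite torus_val_order //.
  by move: xr; rewrite /in_range rE => -[].
Qed.

(** * Products of basis elements *)

(** Moving a unit of exponent at i to the left past one at a larger index costs a
    factor chi_i^-1. *)
Definition chi i : k := if (i < m)%N then - q else q.

Implicit Types S T : 'I_(m + n) -> nat.

(** All powers of -q and q in the multiplication rule, gathered in one bicharacter
    ([twist_star]).  Since j < i, the left exponent is never in I_0 while the right one
    is in I_1, the pair of types for which that rule has no factor. *)
Definition twist (S T : 'I_(m + n) -> nat) : k :=
  \prod_(i < m + n) \prod_(j < m + n | (j < i)%N) chi j ^+ (S i * T j).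

Lemma chi_neq0 i : chi i != 0.
Proof. by rewrite /chi; case: ifP; rewrite ?oppr_eq0. Qed.

Lemma eq_twist S S' T T' : S =1 S' -> T =1 T' -> twist S T = twist S' T'.
Proof.
by move=> eu ew; apply: eq_bigr => i _; apply: eq_bigr => j _; rewrite eu ew.
Qed.

Lemma twistDl S S' T : twist (fun i => S i + S' i)%N T = twist S T * twist S' T.
Proof.
rewrite /twist -big_split; apply: eq_bigr => i _; rewrite -big_split.
by apply: eq_bigr => j _; rewrite mulnDl exprD.
Qed.

Lemma twistDr S T T' : twist S (fun i => T i + T' i)%N = twist S T * twist S T'.
Proof.
rewrite /twist -big_split; apply: eq_bigr => i _; rewrite -big_split.
by apply: eq_bigr => j _; rewrite mulnDr exprD.
Qed.

Lemma expr_star (c : k) S T :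
  c ^+ star S T = \prod_(i < m + n) \prod_(j < m + n | (j < i)%N) c ^+ (S i * T j).
Proof. by rewrite /star -prodrXr; apply: eq_bigr => i _; rewrite prodrXr. Qed.

Lemma twist_star x y : twist (val_at x) (val_at y) =
  (- q) ^+ star (vec1 m x.2) (vec0 n y.1) * (- q) ^+ star (vec0 n x.1) (vec0 n y.1) *
  q ^+ star (vec1 m x.2) (vec1 m y.2).
Proof.
rewrite !expr_star -!big_split; apply: eq_bigr => i _; rewrite -!big_split.
apply: eq_bigr => j ji /=; rewrite /chi /val_at /vec0 /vec1.
case: (split_ordP j) => [b ej|b ej].
  by rewrite muln0 expr0 mulr1; case: split => c; rewrite mul0n expr0 ?mul1r ?mulr1.
rewrite !muln0 !expr0 !mul1r; case: (split_ordP i) => [c ei|//].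
by move: ji; rewrite ei ej /= ltnNge ltnW // (leq_trans (ltn_ord c)) // leq_addr.
Qed.

(** On I_0 this is 0 when x^mu and x^nu share a factor, so that the case distinction
    in the multiplication rule becomes part of the coefficient. *)
Definition site_coef i v w : k :=
  if (i < m)%N then (~~ ((0 < v)%N && (0 < w)%N))%:R else qbin q (v + w) v.

Hypothesis xbM : forall x y, xb x * xb y =
  if mu_clash x.1 y.1 then 0 else omul_coef q x y *: xb (omul_idx x y).

Lemma xbM_sites x y : xb x * xb y =
  ((twist (val_at x) (val_at y))^-1 *
     \prod_(i < m + n) site_coef i (val_at x i) (val_at y i)) *: xb (omul_idx x y).
Proof.
rewrite xbM /omul_coef big_split_ord /= /val_at /site_coef.
rewrite (eq_bigr (fun b : 'I_m => (~~ (x.1 b && y.1 b))%:R)); last first.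
  by move=> i _; rewrite (unsplitK (inl i)) /= ltn_ord; case: (x.1 i); case: (y.1 i).
rewrite [X in _ = (_ * (_ * X)) *: _]
  (eq_bigr (fun b : 'I_n => qbin q (x.2 b + y.2 b) (x.2 b))); last first.
  by move=> i _; rewrite (unsplitK (inr i)) /= ltnNge leq_addr.
rewrite twist_star; case: ifP => [/existsP[i xyi]|/negbT].
  by rewrite (bigD1 i) //= xyi !(mul0r, mulr0) scale0r.
rewrite negb_exists => /forallP c; rewrite [\prod_(b < m) _]big1 ?mul1r; last first.
  by move=> i _; rewrite c.
by congr (_ *: _); rewrite !invfM !mulrA.
Qed.

(** The dependence of the bicharacter on the exponents of the left and of the right
    factor at i, see [twist_put]. *)
Definition chi_below i y : k := \prod_(j < m + n | (j < i)%N) chi j ^+ val_at y j.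
Definition chi_above i x : k := \prod_(j < m + n | (i < j)%N) chi i ^+ val_at x j.

Lemma twist_deltal i v T :
  twist (fun j => (j == i) * v)%N T =
  (\prod_(j < m + n | (j < i)%N) chi j ^+ T j) ^+ v.
Proof.
rewrite /twist (bigD1 i) //= [X in _ * X]big1 => [|i' /negPf ni']; last first.
  by rewrite big1 // => j _; rewrite ni' mul0n expr0.
rewrite mulr1 -prodrXl; apply: eq_bigr => j _.
by rewrite eqxx mul1n mulnC exprM.
Qed.

Lemma twist_deltar i S v :
  twist S (fun j => (j == i) * v)%N =
  (\prod_(j < m + n | (i < j)%N) chi i ^+ S j) ^+ v.
Proof.
rewrite -prodrXl [RHS]big_mkcond; apply: eq_bigr => j _ /=; case: ifP => ij.
  rewrite (bigD1 i) //= big1 ?mulr1 => [|j' /andP[_ /negPf nj']].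
    by rewrite eqxx mul1n exprM.
  by rewrite nj' muln0 expr0.
by rewrite big1 // => j' j'j; case: eqP => [e|_]; rewrite ?muln0 ?expr0 // -e j'j in ij *.
Qed.

Lemma val_put_split x i v : fits i v ->
  val_at (put_at x i v) =1 (fun j => val_at (put_at x i 0) j + (j == i) * v)%N.
Proof.
move=> fv j; have f0 : fits i 0 by rewrite /fits implybT.
by rewrite !val_put //; case: eqP => _; rewrite ?mul1n // addn0.
Qed.

Lemma twist_put x y i v w : fits i v -> fits i w ->
  twist (val_at (put_at x i v)) (val_at (put_at y i w)) =
  twist (val_at (put_at x i 0)) (val_at (put_at y i 0)) *
    chi_below i y ^+ v * chi_above i x ^+ w.
Proof.
move=> fv fw.
rewrite (eq_twist (val_put_split x fv) (frefl _)) twistDl twist_deltal.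
rewrite (eq_twist (frefl _) (val_put_split y fw)) twistDr twist_deltar mulrAC.
congr (_ * _ ^+ _ * _ ^+ _); apply: eq_bigr => j ji; rewrite val_put_neq //.
  by apply: contraTneq ji => ->; rewrite ltnn.
by apply: contraTneq ji => ->; rewrite ltnn.
Qed.

Lemma omul_idx_put x y i v w :
  omul_idx (put_at x i v) (put_at y i w) = put_at (omul_idx x y) i (v + w).
Proof.
rewrite /omul_idx /put_at /mu_add /al_add; case: split => b /=; congr pair;
  apply/ffunP => c; rewrite !ffunE //; case: eqP => // _.
by rewrite addn_gt0.
Qed.

(** The part of the coefficient of a product that does not involve the exponents
    at i. *)
Definition cofactor_coef x y i : k :=
  (twist (val_at (put_at x i 0)) (val_at (put_at y i 0)))^-1 *
  \prod_(j < m + n | j != i) site_coef j (val_at x j) (val_at y j).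

Lemma xbM_put x y i v w : fits i v -> fits i w ->
  xb (put_at x i v) * xb (put_at y i w) =
  (cofactor_coef x y i * chi_below i y ^- v * chi_above i x ^- w * site_coef i v w)
    *: xb (put_at (omul_idx x y) i (v + w)).
Proof.
move=> fv fw; rewrite xbM_sites twist_put // omul_idx_put (bigD1 i) //=.
rewrite !val_put_same // /cofactor_coef.
rewrite (eq_bigr (fun j => site_coef j (val_at x j) (val_at y j))); last first.
  by move=> j ji; rewrite !val_put_neq.
by congr (_ *: _); rewrite !invfM; ring.
Qed.

Lemma fits_add i v w : fits i v -> fits i w -> site_coef i v w != 0 -> fits i (v + w).
Proof.
by rewrite /fits /site_coef; case: (i < m)%N v w => [] [|[|v]] [|[|w]] //=; rewrite eqxx.
Qed.

Lemma ladder_xbM_put s x y i v w : fits i v -> fits i w ->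
  ladder s i (xb (put_at x i v) * xb (put_at y i w)) =
  (cofactor_coef x y i * chi_below i y ^- v * chi_above i x ^- w *
     (site_coef i v w * ladder_coef s i (v + w)))
    *: xb (put_at (omul_idx x y) i (step s (v + w))).
Proof.
move=> fv fw; rewrite xbM_put // ladderZ.
have [->|nz] := eqVneq (site_coef i v w) 0; first by rewrite mul0r !mulr0 !scale0r.
by rewrite ladder_put ?fits_add // scalerA -!mulrA.
Qed.

Lemma site_raise_l i v w : fits i v -> fits i w ->
  site_coef i v w * ladder_coef true i (v + w) = ladder_coef true i v * site_coef i v.+1 w.
Proof.
rewrite /fits /site_coef /ladder_coef; case: (i < m)%N => /=.
  by case: v w => [|[|v]] [|[|w]] //= _ _; rewrite ?(mulr0, mul0r, mulr1).
by move=> _ _; rewrite qbin_upl // mulrC.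
Qed.

Lemma site_raise_r i v w : fits i v -> fits i w ->
  site_coef i v w * ladder_coef true i (v + w) = ladder_coef true i w * site_coef i v w.+1.
Proof.
rewrite /fits /site_coef /ladder_coef; case: (i < m)%N => /=.
  by case: v w => [|[|v]] [|[|w]] //= _ _; rewrite ?(mulr0, mul0r, mulr1).
by move=> _ _; rewrite qbin_upr // mulrC.
Qed.

(** On I_1 this is [qbin_pascal1]; on I_0 the only nontrivial case is v = w = 1, where
    the two terms on the right cancel because chi_i = - q_i. *)
Lemma site_lower1 i v w : fits i v -> fits i w ->
  site_coef i v w * ladder_coef false i (v + w) =
  qq q i ^- w * ladder_coef false i v * site_coef i v.-1 w +
  chi i ^- v * ladder_coef false i w * site_coef i v w.-1.
Proof.
rewrite /fits /site_coef /ladder_coef /qq /chi; case: (i < m)%N => /=.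
  case: v w => [|[|v]] [|[|w]] //= _ _; rewrite ?expr0 ?expr1 ?invr1 ?invrN; ring.
move=> _ _; case: v w => [|v] [|w]; rewrite ?add0n ?addn0 ?qbin0 ?qbinn ?expr0 ?invr1 /=.
- by ring.
- by rewrite ?qbin0 ?qbinn; ring.
- by rewrite ?qbin0 ?qbinn; ring.
by rewrite qbin_pascal1 // exprVn invrK; ring.
Qed.

(** The same from [qbin_pascal2]. *)
Lemma site_lower2 i v w : fits i v -> fits i w ->
  site_coef i v w * ladder_coef false i (v + w) =
  chi i ^- w * ladder_coef false i v * site_coef i v.-1 w +
  qq q i ^- v * ladder_coef false i w * site_coef i v w.-1.
Proof.
rewrite /fits /site_coef /ladder_coef /qq /chi; case: (i < m)%N => /=.
  case: v w => [|[|v]] [|[|w]] //= _ _; rewrite ?expr0 ?expr1 ?invr1 ?invrN; ring.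
move=> _ _; case: v w => [|v] [|w]; rewrite ?add0n ?addn0 ?qbin0 ?qbinn ?expr0 ?invr1 /=.
- by ring.
- by rewrite ?qbin0 ?qbinn; ring.
- by rewrite ?qbin0 ?qbinn; ring.
by rewrite qbin_pascal2 // exprVn invrK; ring.
Qed.

Lemma chi_below_neq0 i y : chi_below i y != 0.
Proof. by apply/prodf_neq0 => j _; rewrite expf_neq0 ?chi_neq0. Qed.

Lemma chi_above_neq0 i x : chi_above i x != 0.
Proof. by apply/prodf_neq0 => j _; rewrite expf_neq0 ?chi_neq0. Qed.

(** The scalar c is arbitrary when i is in I_0 and y has exponent 1 there, since both
    sides then vanish.  This freedom is what makes one formula work for both kinds of
    index in [root_op_E_xbM] and [root_op_F_xbM]. *)
Lemma raise_mull i x y c : ((m <= i)%N || (val_at y i == 0)%N -> c = chi_below i y) ->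
  ladder true i (xb x * xb y) = c *: (ladder true i (xb x) * xb y).
Proof.
have := fits_val x i; have := fits_val y i.
suff main v w : fits i w -> fits i v -> ((m <= i)%N || (w == 0)%N -> c = chi_below i y) ->
    ladder true i (xb (put_at x i v) * xb (put_at y i w)) =
    c *: (ladder true i (xb (put_at x i v)) * xb (put_at y i w)).
  by move=> fw fv /(main _ _ fw fv); rewrite !put_val.
move=> fw fv cE; rewrite ladder_xbM_put // ladder_put // site_raise_l // -scalerAl.
have [->|nz] := eqVneq (ladder_coef true i v) 0.
  by rewrite mul0r mulr0 !scale0r scaler0.
rewrite xbM_put ?(fits_step (s := true)) // !scalerA /= addSn.
case: (boolP ((m <= i)%N || (w == 0)%N)) cE => [_ -> // | + _].
  congr (_ *: _); rewrite exprS invfM; field.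
  by rewrite !expf_neq0 ?chi_below_neq0 ?chi_above_neq0.
rewrite negb_or -ltnNge -lt0n => /andP[im w0].
by rewrite /site_coef im w0 !(mulr0, scale0r).
Qed.

Lemma raise_mulr i x y c : ((m <= i)%N || (val_at x i == 0)%N -> c = chi_above i x) ->
  ladder true i (xb x * xb y) = c *: (xb x * ladder true i (xb y)).
Proof.
have := fits_val x i; have := fits_val y i.
suff main v w : fits i w -> fits i v -> ((m <= i)%N || (v == 0)%N -> c = chi_above i x) ->
    ladder true i (xb (put_at x i v) * xb (put_at y i w)) =
    c *: (xb (put_at x i v) * ladder true i (xb (put_at y i w))).
  by move=> fw fv /(main _ _ fw fv); rewrite !put_val.
move=> fw fv cE; rewrite ladder_xbM_put // (ladder_put _ _ fw) site_raise_r // -scalerAr.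
have [->|nz] := eqVneq (ladder_coef true i w) 0.
  by rewrite mul0r mulr0 !scale0r scaler0.
rewrite xbM_put ?(fits_step (s := true)) // !scalerA /= addnS.
case: (boolP ((m <= i)%N || (v == 0)%N)) cE => [_ -> // | + _].
  congr (_ *: _); rewrite exprS invfM; field.
  by rewrite !expf_neq0 ?chi_below_neq0 ?chi_above_neq0.
rewrite negb_or -ltnNge -lt0n => /andP[im v0].
by rewrite /site_coef im v0 !(mulr0, scale0r).
Qed.

(** The exponents at i enter through the one-index rule with factors lam and rho, the
    other exponents through the bicharacter. *)
Lemma lower_mul i x y (rho lam : nat -> k) :
    (forall v w, fits i v -> fits i w ->
      site_coef i v w * ladder_coef false i (v + w) =
      lam w * ladder_coef false i v * site_coef i v.-1 w +
      rho v * ladder_coef false i w * site_coef i v w.-1) ->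
  ladder false i (xb x * xb y) =
  ((chi_below i y)^-1 * lam (val_at y i)) *: (ladder false i (xb x) * xb y) +
  ((chi_above i x)^-1 * rho (val_at x i)) *: (xb x * ladder false i (xb y)).
Proof.
move=> site; have := fits_val x i; have := fits_val y i.
suff main v w : fits i w -> fits i v ->
    ladder false i (xb (put_at x i v) * xb (put_at y i w)) =
    ((chi_below i y)^-1 * lam w) *: (ladder false i (xb (put_at x i v)) * xb (put_at y i w)) +
    ((chi_above i x)^-1 * rho v) *: (xb (put_at x i v) * ladder false i (xb (put_at y i w))).
  by move=> fw fv; have := main _ _ fw fv; rewrite !put_val.
move=> fw fv; rewrite ladder_xbM_put // (ladder_put _ _ fv) (ladder_put _ _ fw) site //.
have fpred u : fits i u -> fits i u.-1.
  by rewrite /fits; case: (i < m)%N u => [] [|[|]].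
rewrite -scalerAl -scalerAr !xbM_put ?fpred //= !scalerA mulrDr scalerDl.
congr (_ + _).
  case: v {fv} => [|v] /=; first by rewrite /ladder_coef ?eqxx !(mulr0, mul0r) !scale0r.
  congr (_ *: _); rewrite exprS invfM; field.
  by rewrite !expf_neq0 ?chi_below_neq0 ?chi_above_neq0.
case: w {fw} => [|w] /=; first by rewrite /ladder_coef ?eqxx !(mulr0, mul0r) !scale0r.
rewrite addnS; congr (_ *: _); rewrite exprS invfM; field.
by rewrite !expf_neq0 ?chi_below_neq0 ?chi_above_neq0.
Qed.

Lemma chi_below_hi (j : 'I_(m + n).-1) y :
  chi_below (hi j) y = chi_below (lo j) y * chi (lo j) ^+ val_at y (lo j).
Proof.
rewrite /chi_below (bigD1 (lo j)) //= mulrC; congr (_ * _); apply: eq_bigl => i.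
by rewrite -val_eqE /= ltnS [RHS]ltn_neqAle andbC.
Qed.

(** If j is not the odd index, chi is the same at j and j + 1.  If it is, chi changes
    from -q to q, and the indices above j are all of I_1, so that the signs multiply
    to (-1)^|alpha|. *)
Lemma chi_above_lo (j : 'I_(m + n).-1) x : chi_above (lo j) x =
  al_sign x ^+ parity j * chi (hi j) ^+ val_at x (hi j) * chi_above (hi j) x.
Proof.
have split_hi c : \prod_(i < m + n | (lo j < i)%N) c ^+ val_at x i =
    c ^+ val_at x (hi j) * \prod_(i < m + n | (hi j < i)%N) c ^+ val_at x i :> k.
  rewrite (bigD1 (hi j)) //=; congr (_ * _); apply: eq_bigl => i.
  by rewrite -val_eqE /=; lia.
rewrite /chi_above; case: (boolP (parity j)) => [pj|npj]; last first.
  have -> : chi (lo j) = chi (hi j).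
    rewrite /chi /=; have -> // : (j < m)%N = (j.+1 < m)%N.
    by move: npj; rewrite /parity; lia.
  by rewrite expr0 mul1r split_hi.
rewrite expr1 -mulrA -split_hi; move: pj; rewrite /parity => /eqP pj.
have lom : (lo j < m)%N by rewrite /=; lia.
have him : (hi j < m)%N = false by rewrite /=; lia.
rewrite {1}/chi lom {1}/chi him.
have -> : al_sign x = \prod_(i < m + n | (lo j < i)%N) (-1) ^+ val_at x i.
  rewrite /al_sign -prodrXr [RHS]big_mkcond [RHS]big_split_ord /=.
  rewrite [X in _ = X * _]big1 ?mul1r => [|i _]; last first.
    by case: ifP => //; have := ltn_ord i; lia.
  apply: eq_bigr => i _; rewrite /val_at (unsplitK (inr i)) ifT //.
  by have := ltn_ord i; lia.
rewrite -big_split; apply: eq_bigr => i _ /=.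
by rewrite -exprMn mulN1r.
Qed.

Lemma qq_chi i v : (m <= i)%N || (v == 0)%N -> qq q i ^+ v * chi i ^+ v = 1.
Proof.
case/orP => [mi|/eqP->]; last by rewrite !expr0 mulr1.
by rewrite -exprMn /qq /chi ltnNge mi /= mulVf // expr1n.
Qed.

Lemma cartan_val_neq0 (j : 'I_(m + n).-1) x : cartan_val j x != 0.
Proof. by rewrite /cartan_val mulf_neq0 ?invr_eq0 ?sigma_neq0. Qed.

(** * The Leibniz rule *)

(** D_{j+1} is distributed over the product by [lower_mul], then X_j is applied to one
    factor of each term.  The scalars given to [raise_mull] and [raise_mulr] are the
    ones that turn the result into the coproduct of E_j. *)
Lemma root_op_E_xbM (j : 'I_(m + n).-1) x y :
  root_op true j (xb x * xb y) =
  root_op true j (xb x) * (cartan_val j y *: xb y) +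
  (al_sign x ^+ parity j *: xb x) * root_op true j (xb y).
Proof.
rewrite /root_op /hop /= (lower_mul _ _ (@site_lower1 (hi j))).
rewrite linearD !ladderZ !(ladder_xb false) -!scalerAl -!scalerAr !ladderZ.
rewrite (@raise_mull (lo j) _ y
  (chi_below (hi j) y * qq q (hi j) ^+ val_at y (hi j) * cartan_val j y)).
  rewrite (@raise_mulr (lo j) x _ (al_sign x ^+ parity j *
     (chi_above (hi j) x * chi (hi j) ^+ val_at x (hi j)))).
    rewrite !linearZ /= -!scalerAl -?scalerAr !scalerA; congr (_ *: _ + _ *: _).
      by field; rewrite chi_below_neq0 expf_neq0 // qq_neq0.
    by field; rewrite chi_above_neq0 expf_neq0 // chi_neq0.
  by move=> _; rewrite chi_above_lo; ring.
move=> c; rewrite chi_below_hi /cartan_val !sigma_valE.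
rewrite -[RHS]mulr1 -(qq_chi c); field.
by rewrite expf_neq0 ?qq_neq0.
Qed.

(** As for E_j, except that D_j is distributed first, by the other one-index rule. *)
Lemma root_op_F_xbM (j : 'I_(m + n).-1) x y :
  root_op false j (xb x * xb y) =
  root_op false j (xb x) * xb y +
  ((al_sign x ^+ parity j / cartan_val j x) *: xb x) * root_op false j (xb y).
Proof.
have lohi : lo j != hi j := lo_neq_hi j.
rewrite /root_op /hop /= !(ladder_comm _ (i := lo j)) ?lohi //.
rewrite (lower_mul _ _ (@site_lower2 (lo j))).
rewrite linearD !ladderZ !(ladder_xb false) -!scalerAl -!scalerAr !ladderZ.
rewrite (@raise_mull (hi j) _ y (chi_below (lo j) y * chi (lo j) ^+ val_at y (lo j))).
  rewrite (@raise_mulr (hi j) x _ (al_sign x ^+ parity j / cartan_val j x *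
     (chi_above (lo j) x * qq q (lo j) ^+ val_at x (lo j)))).
    rewrite !linearZ /= -!scalerAl -?scalerAr !scalerA; congr (_ *: _ + _ *: _).
      by field; rewrite chi_below_neq0 expf_neq0 // chi_neq0.
    by field; rewrite cartan_val_neq0 chi_above_neq0 expf_neq0 // qq_neq0.
  move=> c; rewrite chi_above_lo /cartan_val !sigma_valE.
  have s2 : al_sign x ^+ parity j * al_sign x ^+ parity j = 1.
    by rewrite -exprMn /al_sign -expr2 sqrr_sign expr1n.
  rewrite -[RHS]mul1r -s2 -[RHS]mulr1 -(qq_chi c); field.
  by rewrite !expf_neq0 ?qq_neq0.
by move=> _; rewrite chi_below_hi.
Qed.

Lemma root_op_E_mul (j : 'I_(m + n).-1) a b :
  root_op true j (a * b) =
  root_op true j a * diag (cartan_val j) b +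
  iter (parity j) (diag al_sign) a * root_op true j b.
Proof.
rewrite iter_diag; set s := fun x => _.
apply: (xb_ext (f := fun a => root_op true j (a * b)) (h := fun a =>
  root_op true j a * diag (cartan_val j) b + diag s a * root_op true j b)).
- by move=> c u v; rewrite mulrDl -scalerAl linearP.
- by move=> c u v; rewrite !linearP !mulrDl -!scalerAl addrACA scalerDr.
move=> x.
apply: (xb_ext (f := fun b => root_op true j (xb x * b)) (h := fun b =>
  root_op true j (xb x) * diag (cartan_val j) b + diag s (xb x) * root_op true j b)).
- by move=> c u v; rewrite mulrDr -scalerAr linearP.
- by move=> c u v; rewrite !linearP !mulrDr -!scalerAr addrACA scalerDr.
by move=> y; rewrite root_op_E_xbM !diag_xb.
Qed.

Lemma root_op_F_mul (j : 'I_(m + n).-1) a b :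
  root_op false j (a * b) =
  root_op false j a * b +
  iter (parity j) (diag al_sign) (diag (fun x => (cartan_val j x)^-1) a) * root_op false j b.
Proof.
rewrite iter_diag diagM; set s := fun x => _.
apply: (xb_ext (f := fun a => root_op false j (a * b))
               (h := fun a => root_op false j a * b + diag s a * root_op false j b)).
- by move=> c u v; rewrite mulrDl -scalerAl linearP.
- by move=> c u v; rewrite !linearP !mulrDl -!scalerAl addrACA scalerDr.
move=> x.
apply: (xb_ext (f := fun b => root_op false j (xb x * b))
               (h := fun b => root_op false j (xb x) * b + diag s (xb x) * root_op false j b)).
- by move=> c u v; rewrite mulrDr -scalerAr linearP.
- by move=> c u v; rewrite !linearP !mulrDr -!scalerAr addrACA scalerDr.
by move=> y; rewrite root_op_F_xbM !diag_xb.
Qed.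

Lemma diag_mul (f : idx -> k) a b :
    (forall x y, mu_clash x.1 y.1 = false -> f (omul_idx x y) = f x * f y) ->
  diag f (a * b) = diag f a * diag f b.
Proof.
move=> fM.
apply: (xb_ext (f := fun a => diag f (a * b)) (h := fun a => diag f a * diag f b)).
- by move=> c u v; rewrite mulrDl -scalerAl linearP.
- by move=> c u v; rewrite !linearP !mulrDl -!scalerAl.
move=> x.
apply: (xb_ext (f := fun b => diag f (xb x * b)) (h := fun b => diag f (xb x) * diag f b)).
- by move=> c u v; rewrite mulrDr -scalerAr linearP.
- by move=> c u v; rewrite !linearP !mulrDr -!scalerAr.
move=> y; rewrite !diag_xb -scalerAl -scalerAr xbM; case: ifP => cxy.
  by rewrite linear0 !scaler0.
by rewrite linearZ /= diag_xb fM // !scalerA; congr (_ *: _); ring.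
Qed.

Lemma val_omul_idx x y i : mu_clash x.1 y.1 = false ->
  val_at (omul_idx x y) i = (val_at x i + val_at y i)%N.
Proof.
move/negbT; rewrite negb_exists => /forallP c; rewrite /val_at /=.
case: split => b; rewrite ffunE //.
by have := c b; case: (x.1 b) (y.1 b) => [] [].
Qed.

Lemma sigmaM i x y : mu_clash x.1 y.1 = false ->
  sigma_val q i (omul_idx x y) = sigma_val q i x * sigma_val q i y.
Proof. by move=> c; rewrite !sigma_valE val_omul_idx // exprD. Qed.

Lemma torus_valM t x y : mu_clash x.1 y.1 = false ->
  torus_val t (omul_idx x y) = torus_val t x * torus_val t y.
Proof.
by move=> c; rewrite /torus_val; case: g t => t; rewrite ?sigmaM // invfM mulrACA.
Qed.

Lemma al_signM x y : al_sign (omul_idx x y) = al_sign x * al_sign y.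
Proof.
by rewrite /al_sign -exprD -big_split; congr (_ ^+ _); apply: eq_bigr => i _; rewrite ffunE.
Qed.

(** * Comparison with the twisted operators *)

Lemma chi_below_put i j y v : (i <= j)%N -> chi_below i (put_at y j v) = chi_below i y.
Proof.
move=> ij; apply: eq_bigr => l li; rewrite val_put_neq // -val_eqE /=.
by rewrite ltn_eqF // (leq_trans li).
Qed.

Lemma in_range_lower i x : in_range x -> in_range (put_at x i (step false (val_at x i))).
Proof.
rewrite /in_range /put_at /val_at; case: r => // l [rl /forallP below]; split=> //.
case: split => b /=; apply/forallP => c; rewrite ?ffunE //.
by case: eqP => // _; apply: leq_ltn_trans (below b); apply: leq_pred.
Qed.

Lemma ladder_in_range s i x : in_range x -> ladder_coef s i (val_at x i) != 0 ->
  in_range (put_at x i (step s (val_at x i))).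
Proof.
case: s => [|xr _]; last exact: in_range_lower.
rewrite /in_range; case: r => // l [rl /forallP below].
rewrite /put_at /val_at /ladder_coef; case: split_ordP => b _ /= nz; split=> //.
  exact/forallP.
apply/forallP => c; rewrite ffunE; case: eqP => // _.
rewrite ltn_neqAle below andbT; apply/eqP => lE; move: nz; rewrite lE.
by case: rl => + _; rewrite -lE => -[-> _]; rewrite eqxx.
Qed.

(** Here X, D and S stand for x_j, d_{j+1} and sigma_j.  By [chi_below_hi] the scalars
    of X and D differ by chi_j^v, with v the exponent at j; it cancels against the
    eigenvalue q_j^v of sigma_j on I_1, and on I_0 only v = 0 is raised. *)
Lemma root_op_E_twisted (X D S : V -> V) (j : 'I_(m + n).-1) x :
    linear X -> linear D -> in_range x ->
    (forall y, in_range y ->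
       X (xb y) = (chi_below (lo j) y)^-1 *: ladder true (lo j) (xb y)) ->
    (forall y, in_range y -> D (xb y) = chi_below (hi j) y *: ladder false (hi j) (xb y)) ->
    (forall y, S (xb y) = sigma_val q (lo j) y *: xb y) ->
  X (D (S (xb x))) = root_op true j (xb x).
Proof.
move=> Xl Dl xr XE DE SE; rewrite SE (linZ Dl) DE // /root_op /hop /= ladder_xb.
rewrite !(linZ Xl) (XE _ (in_range_lower _ xr)) ladderZ.
rewrite chi_below_put ?leqnSn // chi_below_hi sigma_valE.
rewrite ladder_xb val_put_neq ?lo_neq_hi //.
case: (boolP ((m <= lo j)%N || (val_at x (lo j) == 0)%N)) => [c|].
  rewrite !scalerA; congr (_ *: _).
  rewrite -[RHS]mul1r -[in RHS](qq_chi c); field; exact: chi_below_neq0.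
rewrite negb_or -ltnNge => /andP[lm /negPf v0].
by rewrite /ladder_coef lm v0 !(scale0r, scaler0).
Qed.

(** Here the cancelling scalars are chi_j^(v-1) and q_j^(v-1), because sigma_j^-1 acts
    after the exponent v at j was lowered. *)
Lemma root_op_F_twisted (X D S : V -> V) (j : 'I_(m + n).-1) x :
    linear X -> linear S -> in_range x ->
    (forall y, in_range y ->
       X (xb y) = (chi_below (hi j) y)^-1 *: ladder true (hi j) (xb y)) ->
    (forall y, in_range y -> D (xb y) = chi_below (lo j) y *: ladder false (lo j) (xb y)) ->
    (forall y, S (xb y) = (sigma_val q (lo j) y)^-1 *: xb y) ->
  S (X (D (xb x))) = root_op false j (xb x).
Proof.
move=> Xl Sl xr XE DE SE; rewrite DE // /root_op /hop /= ladder_comm ?lo_neq_hi //.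
rewrite ladder_xb !(linZ Xl) (XE _ (in_range_lower _ xr)) ladderZ ladder_xb.
rewrite val_put_neq 1?eq_sym ?lo_neq_hi // !(linZ Sl) SE chi_below_hi chi_below_put //.
rewrite sigma_valE (val_put_neq _ _ (lo_neq_hi j)) !scalerA.
have f1 : fits (lo j) (val_at x (lo j)).-1.
  by move: (fits_val x (lo j)); rewrite /fits; case: (_ < m)%N (val_at _ _) => [] [|[|]].
rewrite val_put_same // /step.
have [v0|v0] := eqVneq (val_at x (lo j)) 0%N.
  have -> : ladder_coef false (lo j) (val_at x (lo j)) = 0 by rewrite /ladder_coef v0 eqxx.
  by rewrite !(mulr0, mul0r) !scale0r.
congr (_ *: _); have c : (m <= lo j)%N || ((val_at x (lo j)).-1 == 0)%N.
  move: (fits_val x (lo j)); rewrite /fits ltnNge.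
  by case: (m <= lo j)%N (val_at _ _) => [] [|[|]].
rewrite -[LHS]mulr1 -(qq_chi c); field.
by rewrite chi_below_neq0 !expf_neq0 ?chi_neq0 ?qq_neq0.
Qed.

Lemma chi_below_star i x : chi_below i x =
  (- q) ^+ star (evec i) (vec0 n x.1) * q ^+ star (evec i) (vec1 m x.2).
Proof.
have st T : star (evec i) T = (\sum_(j < m + n | (j < i)%N) T j)%N.
  rewrite /star (bigD1 i) //= [X in (_ + X)%N]big1 ?addn0 => [|l /negPf li]; last first.
    by rewrite big1 // => j _; rewrite /evec eq_sym li.
  by apply: eq_bigr => j _; rewrite /evec eqxx mul1n.
rewrite !st -!prodrXr -big_split; apply: eq_bigr => j _ /=.
rewrite /chi /val_at /vec0 /vec1.
by case: (split_ordP j) => b _; rewrite expr0 ?mulr1 ?mul1r.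
Qed.

(** * The module algebra structure on a subalgebra *)

Section Transfer.
(** A is the algebra acted upon, identified by emb with a subalgebra of V.  That it
    lies in the span of the basis elements in range is expressed by [emb_ext]. *)
Variables (A : algType k) (emb : A -> V).
Hypotheses (emb_linear : linear emb) (embM : {morph emb : a b / a * b})
  (emb1 : emb 1 = xb (oidx0 m n)) (emb_inj : injective emb).
Hypothesis emb_ext : forall f h : V -> V, linear f -> linear h ->
  (forall x, in_range x -> f (xb x) = h (xb x)) -> forall a : A, f (emb a) = h (emb a).
Variable opA : gen g m n -> A -> A.
Hypothesis emb_op : forall z (a : A), emb (opA z a) = gen_op z (emb a).

Lemma opA_linear z : linear (opA z).
Proof.
by move=> c a b; apply: emb_inj; rewrite emb_linear !emb_op emb_linear linearP.
Qed.

Lemma emb_tact (T : term k (gen g m n)) (a : A) : emb (tact opA T a) = act T (emb a).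
Proof.
elim: T a => [z|c|S IHS T IHT|S IHS T IHT] a /=.
- exact: emb_op.
- exact: linZ emb_linear c a.
- by rewrite (linD emb_linear) IHS IHT.
- by rewrite IHS IHT.
Qed.

Lemma act_linear (T : term k (gen g m n)) : linear (act T).
Proof. by apply: tact_linear => z; apply: linearP. Qed.

Lemma opA_rel (S T : term k (gen g m n)) :
  ap_rel (uq_pres q m n g r) S T -> tact opA S =1 tact opA T.
Proof.
move=> ST a; apply: emb_inj; rewrite !emb_tact.
by apply: (emb_ext (act_linear S) (act_linear T)) => x; apply: gen_op_rel.
Qed.

Definition uact : Uq q m n g r -> A -> A := pact opA (P := uq_pres q m n g r).

Lemma uactE (T : term k (gen g m n)) (a : A) : uact (ucls q r T) a = tact opA T a.
Proof. exact: (pactE opA_linear opA_rel). Qed.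

Lemma emb_uact (T : term k (gen g m n)) (a : A) : emb (uact (ucls q r T) a) = act T (emb a).
Proof. by rewrite uactE emb_tact. Qed.

Lemma uactM u u' (a : A) : uact (u * u') a = uact u (uact u' a).
Proof. exact: (pactM opA_linear opA_rel). Qed.

Lemma uact1 (a : A) : uact 1 a = a.
Proof. exact: (pact1 opA_linear opA_rel). Qed.

Lemma emb_uS (a : A) : emb (uact (uS q m n g r) a) = diag al_sign (emb a).
Proof. exact: emb_uact. Qed.
Lemma emb_uK t (a : A) : emb (uact (uK q r t) a) = diag (torus_val t) (emb a).
Proof. exact: emb_uact. Qed.
Lemma emb_uKV t (a : A) :
  emb (uact (uKV q r t) a) = diag (fun x => (torus_val t x)^-1) (emb a).
Proof. exact: emb_uact. Qed.
Lemma emb_uE (j : 'I_(m + n).-1) (a : A) : emb (uact (uE q g r j) a) = root_op true j (emb a).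
Proof. exact: emb_uact. Qed.
Lemma emb_uF (j : 'I_(m + n).-1) (a : A) : emb (uact (uF q g r j) a) = root_op false j (emb a).
Proof. exact: emb_uact. Qed.

Lemma ucKE (j : 'I_(m + n).-1) : ucK q g r j = ucls q r (tcK k g j).
Proof. by rewrite /ucK /tcK /cartan; case: g => //; apply/esym/pclsM. Qed.

Lemma ucKVE (j : 'I_(m + n).-1) : ucKV q g r j = ucls q r (tcKV k g j).
Proof. by rewrite /ucKV /tcKV /cartan; case: g => //; apply/esym/pclsM. Qed.

Lemma emb_ucK (j : 'I_(m + n).-1) (a : A) :
  emb (uact (ucK q g r j) a) = diag (cartan_val j) (emb a).
Proof. by rewrite ucKE emb_uact act_tcK. Qed.

Lemma emb_ucKV (j : 'I_(m + n).-1) (a : A) :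
  emb (uact (ucKV q g r j) a) = diag (fun x => (cartan_val j x)^-1) (emb a).
Proof. by rewrite ucKVE emb_uact act_tcKV. Qed.

Lemma emb_uSX N (a : A) : emb (uact (uS q m n g r ^+ N) a) = iter N (diag al_sign) (emb a).
Proof.
elim: N a => [|N IH] a; first by rewrite expr0 uact1.
by rewrite exprS uactM emb_uS IH.
Qed.

Lemma root_op_one s (j : 'I_(m + n).-1) : root_op s j (xb (oidx0 m n)) = 0.
Proof.
have v0 i : val_at (oidx0 m n) i = 0%N by rewrite /val_at; case: split => b; rewrite ffunE.
have d0 i : ladder false i (xb (oidx0 m n)) = 0.
  by rewrite ladder_xb v0 /ladder_coef eqxx scale0r.
rewrite /root_op /hop /=; case: s => /=; first by rewrite d0 linear0.
by rewrite ladder_comm ?lo_neq_hi // d0 linear0.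
Qed.

Lemma opA_one z : opA z 1 = gen_eps k z *: 1.
Proof.
apply: emb_inj; rewrite emb_op (linZ emb_linear) emb1.
have v0 i : val_at (oidx0 m n) i = 0%N by rewrite /val_at; case: split => b; rewrite ffunE.
have s0 i : sigma_val q i (oidx0 m n) = 1 by rewrite sigma_valE v0 expr0.
have k0 t : torus_val t (oidx0 m n) = 1.
  by rewrite /torus_val; case: g t => t; rewrite ?s0 ?divr1.
case: z => [j|j|t|t|]; rewrite ?scale0r ?scale1r.
- exact: root_op_one.
- exact: root_op_one.
- by rewrite diag_xb k0 scale1r.
- by rewrite diag_xb k0 invr1 scale1r.
- by rewrite diag_xb /al_sign big1 ?scale1r // => i _; rewrite ffunE.
Qed.

(** The Leibniz rule is proved along the inductive description of the coproduct: for
    the generators it is transported from V, and it is stable under linear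
    combinations, products and equality of tensors. *)
Lemma uact_module_algebra :
  module_algebra (@coproduct k q m n g r) (@counit k q m n g r) uact.
Proof.
have lin1 u : linear (uact u) by apply: (pact_linear opA_linear).
have lin2 (a : A) : linear (uact^~ a).
  move=> c u v; rewrite /uact (pactDl opA_linear opA_rel) (pactZl opA_linear opA_rel) //.
split.
- by [].
- by split=> [a|u u' a]; [apply: uact1 | apply: uactM].
- move=> u s a b c; elim: c a b => {u s}.
  + move=> a b; rewrite big_seq1; apply: emb_inj; rewrite embM !emb_uS embM.
    by rewrite diag_mul // => x y _; apply: al_signM.
  + move=> t a b; rewrite big_seq1; apply: emb_inj; rewrite embM !emb_uK embM.
    by rewrite diag_mul // => x y; apply: torus_valM.
  + move=> t a b; rewrite big_seq1; apply: emb_inj; rewrite embM !emb_uKV embM.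
    by rewrite diag_mul // => x y c; rewrite torus_valM // invfM.
  + move=> j a b; rewrite big_cons big_seq1; apply: emb_inj.
    by rewrite (linD emb_linear) !embM !emb_uE embM emb_uSX emb_ucK root_op_E_mul.
  + move=> j a b; rewrite big_cons big_seq1; apply: emb_inj.
    rewrite (linD emb_linear) !embM !emb_uF embM uact1.
    by rewrite uactM emb_uSX emb_ucKV root_op_F_mul.
  + by move=> a b; rewrite big_seq1 !uact1.
  + by move=> u v s t _ IHu _ IHv a b; rewrite (linD (lin2 _)) big_cat IHu IHv.
  + move=> c u s _ IH a b; rewrite (linZ (lin2 _)) IH scaler_sumr big_map.
    by apply: eq_bigr => p _; rewrite (linZ (lin2 _)) scalerAl.
  + move=> u v s t _ IHu _ IHv a b; rewrite uactM IHv big_allpairs_dep /=.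
    rewrite exchange_big /=; transitivity (\sum_(y <- t) uact u (uact y.1 a * uact y.2 b)).
      elim: t {IHv} => [|y t IH]; first by rewrite !big_nil (lin0 (lin1 _)).
      by rewrite !big_cons (linD (lin1 _)) IH.
    apply: eq_bigr => y _; rewrite IHu; apply: eq_bigr => x _.
    by rewrite !uactM.
  + move=> u s t _ IH st a b; rewrite IH.
    apply: (st _ (fun u1 u2 => uact u1 a * uact u2 b)) => [u'|v'] c u1 u2.
      by rewrite lin2 mulrDr -scalerAr.
    by rewrite lin2 mulrDl -scalerAl.
- by move=> u; apply: (pact_aug opA_linear opA_rel); apply: opA_one.
Qed.

End Transfer.

End Ladders.

(** * The quantum dual Grassmann superalgebra *)

Section OmegaOperators.
Variables (k : fieldType) (q : k) (m n : nat) (r : option nat).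
Local Notation idx := (oidx m n).
Local Notation omega := (omega q m n).
Local Notation xb := (@xb k q m n).

Definition omega_ext (f : idx -> omega) : {linear omega -> omega} := Defs.olift f.

Lemma omega_extE f x : omega_ext f (xb x) = f x.
Proof. exact: olift_xb. Qed.

Local Notation ladder := (ladder q xb omega_ext).
Local Notation in_range := (@in_range k q m n r).

Lemma xcap_in_range x : in_range x -> xcap q r x = xb x.
Proof. by rewrite /in_range /xcap; case: r => // l [_ ->]. Qed.

Lemma sop_xb j x : sop j (xb x) = sigma_val q j x *: xb x.
Proof. exact: olift_xb. Qed.

Lemma sopV_xb j x : sopV j (xb x) = (sigma_val q j x)^-1 *: xb x.
Proof. exact: olift_xb. Qed.

Lemma dop_xb j x : in_range x -> dop r j (xb x) = chi_below q j x *: ladder false j (xb x).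
Proof.
move=> xr; rewrite (ladder_xb q omega_extE) /dop olift_xb scalerA chi_below_star.
have := xcap_in_range (in_range_lower j xr); move: xr; rewrite /put_at /val_at.
case: (split_ordP j) (@star_vec1_fermi m n j x.2) => [b jE|b jE] sv xr.
  rewrite /= sv ?jE //= expr0 mulr1 /ladder_coef; case: (x.1 b) => /= cap.
    by rewrite mulr1 -cap.
  by rewrite mulr0 scale0r.
rewrite /ladder_coef; case E: (x.2 b) => [|v] /= cap; first by rewrite mulr0 scale0r.
rewrite mulr1; congr (_ *: _); rewrite -cap; congr (xcap _ _ (_, _)).
apply/ffunP => c; rewrite !ffunE; case: eqP => [->|_]; last by rewrite subn0.
by rewrite E subn1.
Qed.

(** In the restricted case xcap drops a term that leaves the range; its coefficient is
    then [l] = 0 by [ladder_in_range], so nothing is lost. *)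
Lemma xop_xb j x : in_range x -> xop r j (xb x) = (chi_below q j x)^-1 *: ladder true j (xb x).
Proof.
move=> xr; rewrite (ladder_xb q omega_extE) /xop olift_xb scalerA chi_below_star.
have := @ladder_in_range _ q _ _ r true j x xr; rewrite /put_at /val_at /ladder_coef /step.
case: (split_ordP j) (@star_vec1_fermi m n j x.2) => [b jE|b jE] sv cap.
  rewrite /= sv ?jE //= expr0 mulr1; move: cap; case: (x.1 b) => /= cap.
    by rewrite mulr0 scale0r.
  by rewrite mulr1 xcap_in_range //; apply: cap; rewrite oner_eq0.
have -> : al_incr x.2 b = [ffun c => if c == b then (x.2 b).+1 else x.2 c].
  by apply/ffunP => c; rewrite !ffunE; case: eqP => [->|_]; rewrite ?addn1 ?addn0.
rewrite invfM; have [->|nz] := eqVneq (qnum q (x.2 b).+1) 0.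
  by rewrite !mulr0 !scale0r.
by rewrite (xcap_in_range (cap nz)).
Qed.

End OmegaOperators.

Section OmegaModuleAlgebra.
Variables (k : fieldType) (q : k) (q0 : q != 0) (q21 : q ^+ 2 != 1).
Variables (m n : nat) (g : gtype) (r : option nat).
Local Notation omega := (omega q m n).
Local Notation xb := (@xb k q m n).
Local Notation in_range := (@in_range k q m n r).
Local Notation omega_ops := (gen_op q xb (@omega_ext k q m n) (g := g)).

Lemma xb_mulE x y : xb x * xb y =
  if mu_clash x.1 y.1 then 0 else omul_coef q x y *: xb (omul_idx x y).
Proof. exact: xbM. Qed.

Lemma omega_module_algebra (A : algType k) (emb : A -> omega) (opA : gen g m n -> A -> A) :
    linear emb -> {morph emb : a b / a * b} -> emb 1 = 1 -> injective emb ->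
    (forall f h : omega -> omega, linear f -> linear h ->
      (forall x, in_range x -> f (xb x) = h (xb x)) -> forall a, f (emb a) = h (emb a)) ->
    (forall a x, emb a = xb x -> in_range x) ->
    (forall z a, emb (opA z a) = omega_ops z (emb a)) ->
  exists act : Uq q m n g r -> A -> A,
    module_algebra (@coproduct k q m n g r) (@counit k q m n g r) act /\
    acts_by_operators emb act.
Proof.
move=> embL embM emb1 embI emb_ext emb_range emb_op.
have lE := @omega_extE k q m n.
have ext := @omega_eq k q m n omega.
exists (uact opA); split.
  exact: (uact_module_algebra lE ext q0 q21 xb_mulE embL embM emb1 embI emb_ext emb_op).
move=> a x ax; have xr := emb_range _ _ ax.
have lx i : linear (xop r i : omega -> omega) := olift_linear _.
have ld i : linear (dop r i : omega -> omega) := olift_linear _.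
have ls i : linear (sopV i : omega -> omega) := olift_linear _.
have lsp i : linear (sop i : omega -> omega) := olift_linear _.
split.
- move=> j; rewrite (emb_uE lE ext q0 q21 embL embI emb_ext emb_op) ax.
  apply/esym/(root_op_E_twisted lE q0 (lx _) (ld _) xr) => y; first exact: xop_xb.
    exact: dop_xb.
  exact: sop_xb.
- move=> j; rewrite (emb_uF lE ext q0 q21 embL embI emb_ext emb_op) ax.
  apply/esym/(root_op_F_twisted lE ext q0 (lx _) (ls _) xr) => y; first exact: xop_xb.
    exact: dop_xb.
  exact: sopV_xb.
- move=> t; rewrite (emb_uK lE ext q0 q21 embL embI emb_ext emb_op) ax (diag_xb lE).
  rewrite /torus_op /torus_val; case: g t {opA emb_op} => t; first by rewrite sop_xb.
  by rewrite /comp sopV_xb (linZ (lsp _)) sop_xb scalerA mulrC.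
- move=> j; rewrite (emb_ucK lE ext q0 q21 embL embI emb_ext emb_op) ax (diag_xb lE).
  by rewrite /comp sopV_xb (linZ (lsp _)) sop_xb scalerA mulrC.
by rewrite (emb_uS lE ext q0 q21 embL embI emb_ext emb_op) ax (diag_xb lE).
Qed.

End OmegaModuleAlgebra.

Section RestrictedOmega.
Variables (k : fieldType) (q : k) (q0 : q != 0) (q21 : q ^+ 2 != 1).
Variables (m n l : nat) (h : restricted_at q l).
Local Notation omega := (omega q m n).
Local Notation xb := (@xb k q m n).

Lemma restr_omega_ext (f f' : omega -> omega) : linear f -> linear f' ->
    (forall x, in_range q (Some l) x -> f (xb x) = f' (xb x)) ->
  forall a : restr_omega m n h, f (restr_val a) = f' (restr_val a).
Proof.
move=> lf lf' e [a /= Sa].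
have fE (f0 : omega -> omega) : linear f0 -> f0 a = Defs.olift (fun x => f0 (xb x)) a.
  by move=> lf0; apply: (omega_eq lf0 (olift_linear _)) => x; rewrite olift_xb.
rewrite (fE f lf) (fE f' lf') olift.unlock; apply: eq_big_seq => x xa.
by rewrite e //; split=> //; apply: (allP Sa).
Qed.

Lemma restr_omega_xb (a : restr_omega m n h) x :
  restr_val a = xb x -> in_range q (Some l) x.
Proof.
case: a => a /= Sa ax; split=> //; move: Sa; rewrite ax => /restr_spanP Sx.
apply: contraT => /Sx /eqP; rewrite /xb mcoeffUU oner_eq0 //.
Qed.

Local Notation omega_ops := (gen_op q xb (@omega_ext k q m n)).

(** The span is stable because raising an exponent l - 1 has coefficient [l] = 0. *)
Lemma gen_op_restr g (z : gen g m n) a :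
  a \in restr_span h -> omega_ops z a \in restr_span h.
Proof.
have [z0 lc] := restr_submod m n h.
have Zc c (b : omega) : b \in restr_span h -> c *: b \in restr_span h.
  by move=> Sb; rewrite -[c *: b]addr0 lc.
have diagS f (b : omega) : b \in restr_span h ->
    diag xb (@omega_ext k q m n) f b \in restr_span h.
  by move=> Sb; apply: restr_olift => // x xl; apply/Zc/restr_xb.
have ladderS s i (b : omega) : b \in restr_span h ->
    ladder q xb (@omega_ext k q m n) s i b \in restr_span h.
  move=> Sb; apply: restr_olift => // x xl.
  have [->|nz] := eqVneq (ladder_coef q s i (val_at x i)) 0; first by rewrite scale0r.
  have xr : in_range q (Some l) x by [].
  by have [_ yl] := ladder_in_range xr nz; apply/Zc/restr_xb.
move=> Sa; case: z => [j|j|t|t|].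
- exact: (ladderS true (lo j) _ (ladderS false (hi j) _ Sa)).
- exact: (ladderS false (lo j) _ (ladderS true (hi j) _ Sa)).
- exact: (diagS _ _ Sa).
- exact: (diagS _ _ Sa).
exact: (diagS _ _ Sa).
Qed.

End RestrictedOmega.

Theorem theorem32 (k : closedFieldType) (hk : [pchar k] =i pred0)
    (q : k) (hq0 : q != 0) (hq2 : q ^+ 2 != 1) (m n : nat) (g : gtype) :
  (exists act : Uq q m n g None -> omega q m n -> omega q m n,
      module_algebra (@coproduct k q m n g None) (@counit k q m n g None) act
      /\ acts_by_operators id act)
  /\
  (forall (l : nat) (h : restricted_at q l),
   exists act : Uq q m n g (Some l) -> restr_omega m n h -> restr_omega m n h,
      module_algebra (@coproduct k q m n g (Some l)) (@counit k q m n g (Some l)) act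
      /\ acts_by_operators (@restr_val k q m n l h) act).
Proof.
split=> [|l h].
  apply: (@omega_module_algebra k q hq0 hq2 m n g None (omega q m n) id
            (gen_op q (@xb k q m n) (@omega_ext k q m n) (g := g))) => //.
  by move=> f f' lf lf' e; apply: omega_eq => // x; apply: e.
pose opA z (a : restr_omega m n h) : restr_omega m n h :=
  RestrOmega (gen_op_restr (z : gen g m n) (valP a)).
apply: (@omega_module_algebra k q hq0 hq2 m n g (Some l) _ (@restr_val k q m n l h) opA) => //.
- exact: val_inj.
- exact: restr_omega_ext.
exact: restr_omega_xb.
Qed.
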